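(* Let $\Lambda$ be a Bedford--McMullen carpet with non-uniform vertical fibres. For all $\theta\in(0,1)$, the $\theta$-intermediate dimension $\dim_{\theta}\Lambda$ exists (i.e. $\underline{\dim}_{\theta}\Lambda=\overline{\dim}_{\theta}\Lambda$) and is given in the following way. For fixed $\theta\in(0,1)$ let $L=L(\theta):=1+\left\lfloor \frac{-\log\theta}{\log\gamma}\right\rfloor$, so that $\gamma^{-L}<\theta\le\gamma^{-(L-1)}$. Then there exists a unique solution $s=s(\theta)\in(\dim_{\mathrm H}\Lambda,\dim_{\mathrm B}\Lambda)$ to the equation $$\gamma^L\theta\log N-(\gamma^L\theta-1)\,t_L(s)+\gamma(1-\gamma^{L-1}\theta)\bigl(\log M-I(t_L(s))\bigr)-s\log n=0,$$ and $s(\theta)=\dim_{\theta}\Lambda$.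
   Context: Carpets. Let $n>m\ge2$ be integers and $\mathcal A\subseteq\{1,\dots,m\}\times\{1,\dots,n\}$ non-empty. For $(i,j)\in\mathcal A$ let $f_{(i,j)}(x,y)=\left(\frac{x+i-1}{m},\frac{y+j-1}{n}\right)$. The Bedford--McMullen carpet $\Lambda$ is the unique non-empty compact set with $\Lambda=\bigcup_{(i,j)\in\mathcal A}f_{(i,j)}(\Lambda)$. Put $N=\#\mathcal A$ and $\gamma=\log n/\log m>1$; let $M>1$ be the number of non-empty columns (values $i$ with $(i,j)\in\mathcal A$ for some $j$), and let $N_1,\dots,N_M$ be the numbers of maps in the non-empty columns, so $N=N_1+\dots+N_M$. $\Lambda$ has non-uniform (vertical) fibres if the $N_j$ are not all equal. $\dim_{\mathrm H}$ and $\dim_{\mathrm B}$ are Hausdorff and box dimension. Intermediate dimensions. $|U|$ denotes diameter; covers are finite or countable. For $\theta\in(0,1]$ and bounded non-empty $F\subset\mathbb R^d$, $\underline{\dim}_{\theta}F$ is the infimum of $s\ge0$ such that for all $\varepsilon>0$ and all $\delta_0>0$ there exist $0<\delta\le\delta_0$ and a cover $\{U_i\}$ of $F$ with $\delta^{1/\theta}\le|U_i|\le\delta$ for all $i$ and $\sum_i|U_i|^s\le\varepsilon$. $\overline{\dim}_{\theta}F$ is the infimum of $s\ge0$ such that for all $\varepsilon>0$ there is $\delta_0>0$ such that for all $0<\delta\le\delta_0$ there is such a cover. If they coincide the common value is $\dim_{\theta}F$. Rate function. $I(t)=\sup_{\lambda\in\mathbb R}\left\{\lambda t-\log\left(\frac1M\sum_{j=1}^M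 N_j^{\lambda}\right)\right\}$. The functions $t_\ell(s)$. For $s\in\mathbb R$ let $T_s(t)=\left(s-\frac{\log M}{\log m}\right)\log n+\gamma I(t)$, and for $\ell\in\mathbb N=\{1,2,\dots\}$ let $t_\ell(s)=T_s^{\ell-1}\left(\left(s-\frac{\log M}{\log m}\right)\log n\right)$, where $T_s^{k}$ is the $k$-fold composition and $T_s^0$ is the identity. The function $I$ may take the value $+\infty$; a value of $s$ for which $t_L(s)$ or $I(t_L(s))$ is not finite is not regarded as a solution of the equation. *)

(* Defs.v *)
From HB Require Import structures.
From mathcomp Require Import all_boot all_order all_algebra.
From mathcomp Require Import all_classical all_reals all_analysis.

Set Implicit Arguments.
Unset Strict Implicit.
Unset Printing Implicit Defensive.

Import Order.TTheory GRing.Theory Num.Theory.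
Import numFieldNormedType.Exports.

Local Open Scope classical_set_scope.
Local Open Scope ring_scope.

(* The library norm on ['rV[R]_d] is the sup norm; diameters here are
   Euclidean. *)
Definition edist (R : realType) (d : nat) (x y : 'rV[R]_d) : R :=
  Num.sqrt (\sum_(k < d) (x 0 k - y 0 k) ^+ 2).

(* The maximum with 0 gives the empty set diameter 0 instead of -oo. *)
Definition diam (R : realType) (d : nat) (U : set 'rV[R]_d) : \bar R :=
  maxe 0%E (ereal_sup [set (edist p.1 p.2)%:E | p in U `*` U]).

(* A finite or countable cover is a family indexed by a subset [J] of [nat]. *)
Definition covers (R : realType) (d : nat) (J : set nat)
    (U : nat -> set 'rV[R]_d) (F : set 'rV[R]_d) : Prop :=
  F `<=` \bigcup_(i in J) U i.

Definition cover_sum (R : realType) (d : nat) (J : set nat)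
    (U : nat -> set 'rV[R]_d) (s : R) : \bar R :=
  \esum_(i in J) (diam (U i) `^ s)%E.

Definition hausdorff_content (R : realType) (d : nat) (s delta : R)
    (F : set 'rV[R]_d) : \bar R :=
  ereal_inf [set x | exists (J : set nat) (U : nat -> set 'rV[R]_d),
    [/\ covers J U F,
        forall i, J i -> (diam (U i) <= delta%:E)%E
      & x = cover_sum J U s]].

Definition hausdorff_measure (R : realType) (d : nat) (s : R)
    (F : set 'rV[R]_d) : \bar R :=
  ereal_sup [set hausdorff_content s delta F | delta in [set x : R | 0 < x]].

Definition hausdorff_dim (R : realType) (d : nat) (F : set 'rV[R]_d) : \bar R :=
  ereal_inf [set s%:E | s in [set s : R | 0 <= s /\
                                          hausdorff_measure s F = 0%E]].

Definition covering_number (R : realType) (d : nat) (F : set 'rV[R]_d)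
    (delta : R) : \bar R :=
  ereal_inf [set k%:R%:E | k in [set k : nat |
    exists U : nat -> set 'rV[R]_d,
      covers `I_k U F /\ forall i, (i < k)%N -> (diam (U i) <= delta%:E)%E]].

(* [lim] returns 0 when the limit does not exist, which leaves no real
   number strictly between a nonnegative dimension and [box_dim F]. *)
Definition box_dim (R : realType) (d : nat) (F : set 'rV[R]_d) : \bar R :=
  lim ((lne (covering_number F delta) * ((- ln delta)^-1)%:E)%E
         @[delta --> 0^'+]).

Definition theta_cover (R : realType) (d : nat) (theta : R)
    (F : set 'rV[R]_d) (s eps delta : R) : Prop :=
  exists (J : set nat) (U : nat -> set 'rV[R]_d),
    [/\ covers J U F,
        forall i, J i ->
          ((delta `^ theta^-1)%:E <= diam (U i))%E /\
          (diam (U i) <= delta%:E)%E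
      & (cover_sum J U s <= eps%:E)%E].

Definition lower_theta_dim (R : realType) (d : nat) (theta : R)
    (F : set 'rV[R]_d) : \bar R :=
  ereal_inf [set s%:E | s in [set s : R | 0 <= s /\
    forall eps : R, 0 < eps -> forall delta0 : R, 0 < delta0 ->
      exists delta : R, [/\ 0 < delta, delta <= delta0
                          & theta_cover theta F s eps delta]]].

Definition upper_theta_dim (R : realType) (d : nat) (theta : R)
    (F : set 'rV[R]_d) : \bar R :=
  ereal_inf [set s%:E | s in [set s : R | 0 <= s /\
    forall eps : R, 0 < eps -> exists delta0 : R, 0 < delta0 /\
      forall delta : R, 0 < delta -> delta <= delta0 ->
        theta_cover theta F s eps delta]].

(* The indices [(i, j) : 'I_m * 'I_n] start from 0, hence [x + i] for
   the usual [x + i - 1]. *)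
Definition carpet_map (R : realType) (m n : nat) (a : 'I_m * 'I_n)
    (p : 'rV[R]_2) : 'rV[R]_2 :=
  \row_(k < 2) (if k == ord0 then (p 0 ord0 + (a.1 : nat)%:R) / m%:R
                else (p 0 ord_max + (a.2 : nat)%:R) / n%:R).

Definition is_carpet (R : realType) (m n : nat) (A : {set 'I_m * 'I_n})
    (Lambda : set 'rV[R]_2) : Prop :=
  [/\ Lambda !=set0, compact Lambda
    & Lambda = \bigcup_(a in [set` A]) (carpet_map a @` Lambda)].

Definition columns (m n : nat) (A : {set 'I_m * 'I_n}) : {set 'I_m} :=
  [set a.1 | a in A]%SET.

Definition column_size (m n : nat) (A : {set 'I_m * 'I_n}) (i : 'I_m) : nat :=
  #|[set j : 'I_n | (i, j) \in A]%SET|.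

Definition nonuniform_fibres (m n : nat) (A : {set 'I_m * 'I_n}) : Prop :=
  ~ {in columns A &, forall i i', column_size A i = column_size A i'}.

Definition carpet_gamma (R : realType) (m n : nat) : R := ln n%:R / ln m%:R.

Definition rate (R : realType) (m n : nat) (A : {set 'I_m * 'I_n})
    (t : R) : \bar R :=
  ereal_sup (range (fun lam : R =>
    (lam * t - ln (#|columns A|%:R^-1 *
       \sum_(i in columns A) (column_size A i)%:R `^ lam))%:E)).

Definition t_first (R : realType) (m n : nat) (A : {set 'I_m * 'I_n})
    (s : R) : R :=
  (s - ln #|columns A|%:R / ln m%:R) * ln n%:R.

(* Once an iterate is infinite, all later ones are. *)
Definition t_step (R : realType) (m n : nat) (A : {set 'I_m * 'I_n})
    (s : R) (t : \bar R) : \bar R :=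
  if t is r%:E then
    ((t_first A s)%:E + (carpet_gamma R m n)%:E * rate A r)%E
  else +oo%E.

Definition t_iter (R : realType) (m n : nat) (A : {set 'I_m * 'I_n})
    (l : nat) (s : R) : \bar R :=
  iter l.-1 (t_step A s) (t_first A s)%:E.

(* [Num.truncn] agrees with the integer part on nonnegative reals, which is
   the case here when [0 < theta <= 1] and [1 < carpet_gamma R m n]. *)
Definition carpet_L (R : realType) (m n : nat) (theta : R) : nat :=
  (1 + Num.truncn (- ln theta / ln (carpet_gamma R m n)))%N.

(* [t] and [I] are real numbers, so that a solution has [t_L(s)] and
   [I(t_L(s))] finite. *)
Definition dim_equation (R : realType) (m n : nat) (A : {set 'I_m * 'I_n})
    (theta s : R) : Prop :=
  let g := carpet_gamma R m n in
  let L := carpet_L m n theta in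
  exists t I : R,
    [/\ t_iter A L s = t%:E,
        rate A t = I%:E
      & g ^+ L * theta * ln #|A|%:R
        - (g ^+ L * theta - 1) * t
        + g * (1 - g ^+ (L - 1) * theta) * (ln #|columns A|%:R - I)
        - s * ln n%:R = 0].

(* Main.v *)
Require Import Defs.
From HB Require Import structures.
From mathcomp Require Import all_boot all_order all_algebra.
From mathcomp Require Import finmap.
From mathcomp Require Import all_classical all_reals all_analysis.
From mathcomp Require Import ring lra zify.

Set Implicit Arguments.
Unset Strict Implicit.
Unset Printing Implicit Defensive.

Import Order.TTheory GRing.Theory Num.Theory.
Import numFieldNormedType.Exports.

Local Open Scope classical_set_scope.
Local Open Scope ring_scope.

(** Write [g] for [ln n / ln m], [M] for the number of non-empty columns, [x_q]
    for the logarithm of the size of the [q]-th column of a code, [S_k] for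
    [x_1 + ... + x_k] and [u] for [(s - ln M / ln m) * ln n], which is the first
    slope [t_1 (s)]. An approximate square of level [k] (height [n^-k], width
    about [n^-k]) is given by [k] complete letters and by the columns of the
    letters up to [g k]. In a cover by approximate squares the cost of a code
    that is covered at level [k] is [exp (S_k - k u)] relative to the uniform
    measure on columns. So the choice of the level [k] in [[K, E]], with
    [E ~ K / theta], is a stopping problem in which the columns up to [g k] are
    known at time [k].

    Its value is found from a product measure on codes: the column [i] has
    weight proportional to [N_i ^ lam] at the positions of one block, the blocks
    end at [E, E / g, E / g^2, ...] down to [K], and the tilt is 1 up to [K].
    The mean of [x_q] in the [j]-th block from the end is the slope [t_j (s)].
    The recursion [t_(j+1) = u + g * I (t_j)] says precisely that the drift of
    [S_k - k u] is compensated by the relative entropy of the columns revealed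
    meanwhile ([block_balance]), so the logarithm of the ratio of cost and mass
    has nearly the same expectation [K * exponent] at all levels of [[K, E]].
    The equation of the theorem is, up to a positive factor, [exponent = 0].

    Let [s] be the root. The logarithm of the ratio of cost and mass is then a
    bounded [drift] plus a centred part, [balance], and both bounds are short.
    - Lower bound. [balance] is a sum of independent centred variables, so by
      [chernoff] it is above [- eta k] at all levels for most codes; then
      [mass_distribution] bounds the cost of every cover
      ([cover_cost_lower_bound], [theta_cover_below]).
    - Upper bound. Since the tilts increase from 0 to 1 from the last block to
      the first one, [balance] at level [k] is the partial sum of the centred
      [x_q] up to [k] minus a convex combination of such partial sums with end
      points in [[K, E]]. Hence every code has a level where it is nonpositive,
      the level where the partial sum is least ([exists_balanced_level]). The
      approximate squares with bounded ratio of cost and mass cover the carpet,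
      and for each level their masses sum to at most 1 ([cover_by_squares],
      [theta_cover_above]).

    To have finite quantities everywhere the rate function is replaced by
    [legendre01], with the supremum over tilts in [[0, 1]]; the modified
    exponent is continuous and strictly decreasing in [u], and it agrees with
    the true one at the root because all slopes are at most the mean for the
    tilt 1 ([slope_le_mean1], [dim_equation_exponent]). The root lies below the
    box dimension, which is the value for the tilt 1 ([box_dim_carpet]). It lies
    above the Hausdorff dimension because the latter is at most the intermediate
    dimension for [theta / g], whose equation has a smaller root
    ([exponent_succ_lt]). Any other solution above the Hausdorff dimension has
    its first slope above the untilted mean, since the measure that is
    equidistributed on columns bounds the Hausdorff dimension from below
    ([hausdorff_dim_ge]); and the exponent is strictly decreasing. *)

(** * The logarithmic moment generating function and its Legendre transform *)

Definition partition_fun (R : realType) (I : finType) (C : {set I}) (x : I -> R)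
  (l : R) : R := \sum_(i in C) expR (l * x i).

HB.lock Definition logmgf (R : realType) (I : finType) (C : {set I}) (x : I -> R)
  (l : R) : R := ln (#|C|%:R^-1 * partition_fun C x l).

Definition tilt (R : realType) (I : finType) (C : {set I}) (x : I -> R)
  (l : R) (i : I) : R := expR (l * x i - logmgf C x l) / #|C|%:R.

(** The derivative of [logmgf]. *)
HB.lock Definition tilt_mean (R : realType) (I : finType) (C : {set I})
  (x : I -> R) (l : R) : R := \sum_(i in C) tilt C x l i * x i.

(** The Legendre transform of the logarithmic moment generating function,
    restricted to tilts in the unit interval: it is finite and Lipschitz on
    the whole line, while the unrestricted one takes the value [+oo]. *)
HB.lock Definition legendre01 (R : realType) (I : finType) (C : {set I})
  (x : I -> R) (t : R) : R := sup [set l * t - logmgf C x l | l in `[0%R, 1%R]].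

Section LogMoment.
Variables (R : realType) (I : finType) (C : {set I}) (x : I -> R).
Hypothesis C_neq0 : C != finset.set0.

Local Notation Z := (partition_fun C x).
Local Notation logmgf := (logmgf C x).
Local Notation tilt := (tilt C x).
Local Notation tilt_mean := (tilt_mean C x).
Local Notation J := (legendre01 C x).

Lemma logmgfE l : logmgf l = ln (#|C|%:R^-1 * Z l).
Proof. by rewrite logmgf.unlock. Qed.

Lemma tilt_meanE l : tilt_mean l = \sum_(i in C) tilt l i * x i.
Proof. by rewrite tilt_mean.unlock. Qed.

Lemma cardC_gt0 : 0 < #|C|%:R :> R.
Proof. by rewrite ltr0n card_gt0. Qed.

Lemma partition_fun_gt0 l : 0 < Z l.
Proof.
have /set0Pn [i iC] := C_neq0.
rewrite /partition_fun (bigD1 i) //= ltr_pwDl ?expR_gt0 //.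
by apply: sumr_ge0 => j _; apply: expR_ge0.
Qed.

Lemma expR_logmgf l : expR (logmgf l) = Z l / #|C|%:R.
Proof.
rewrite logmgfE lnK; first by rewrite mulrC.
by rewrite posrE mulr_gt0 ?partition_fun_gt0 // invr_gt0 cardC_gt0.
Qed.

Lemma tiltE l i : tilt l i = expR (l * x i) / Z l.
Proof.
rewrite /tilt expRD expRN expR_logmgf.
have := partition_fun_gt0 l; have := cardC_gt0.
move=> /lt0r_neq0 h1 /lt0r_neq0 h2.
by field; rewrite h1 h2.
Qed.

Lemma tilt_gt0 l i : 0 < tilt l i.
Proof. by rewrite /tilt mulr_gt0 ?expR_gt0 // invr_gt0 cardC_gt0. Qed.

Lemma sum_tilt l : \sum_(i in C) tilt l i = 1.
Proof.
under eq_bigr do rewrite tiltE.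
by rewrite -mulr_suml divff // lt0r_neq0 // partition_fun_gt0.
Qed.

Lemma sum_tilt_centred l : \sum_(i in C) tilt l i * (x i - tilt_mean l) = 0.
Proof.
under eq_bigr do rewrite mulrBr.
by rewrite sumrB -mulr_suml sum_tilt mul1r tilt_meanE subrr.
Qed.

Lemma logmgf0 : logmgf 0 = 0.
Proof.
rewrite logmgfE /partition_fun.
under eq_bigr do rewrite mul0r expR0.
rewrite sumr_const mulVf ?ln1 //.
exact/lt0r_neq0/cardC_gt0.
Qed.

(** Jensen's inequality for the weights tilted by [l]. *)
Lemma logmgf_tangent l l' : logmgf l + (l' - l) * tilt_mean l <= logmgf l'.
Proof.
rewrite -ler_expR expRD !expR_logmgf mulrAC ler_pM2r ?invr_gt0 ?cardC_gt0 //.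
set u := l' - l; set mu := tilt_mean l.
suff : expR (u * mu) <= \sum_(i in C) tilt l i * expR (u * x i).
  move=> h.
  apply: (@le_trans _ _
    (Z l * \sum_(i in C) tilt l i * expR (u * x i))).
    by rewrite ler_pM2l ?partition_fun_gt0.
  rewrite mulr_sumr [leRHS]/partition_fun; apply: ler_sum => i _.
  have /lt0r_neq0 Z0 := partition_fun_gt0 l.
  rewrite tiltE mulrA (mulrC (Z l)) divfK // -expRD /u -mulrDl.
  by rewrite addrC subrK.
have -> : expR (u * mu) =
    \sum_(i in C) tilt l i * (expR (u * mu) * (1 + u * (x i - mu))).
  under eq_bigr do rewrite mulrCA mulrDr mulr1 (mulrCA _ u).
  rewrite -mulr_sumr big_split /= -mulr_sumr sum_tilt_centred sum_tilt.
  by rewrite mulr0 addr0 mulr1.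
apply: ler_sum => i _; rewrite ler_pM2l ?tilt_gt0 //.
have -> : u * x i = u * mu + u * (x i - mu) by ring.
by rewrite expRD ler_pM2l ?expR_gt0 // expR_ge1Dx.
Qed.

Lemma tilt_mean_le l l' : l <= l' -> tilt_mean l <= tilt_mean l'.
Proof.
rewrite le_eqVlt => /predU1P[-> //|ll'].
have h1 := logmgf_tangent l l'; have h2 := logmgf_tangent l' l.
rewrite -(ler_pM2l (_ : 0 < l' - l)) ?subr_gt0 //; lra.
Qed.

Lemma tilt_mean_lt_inv l l' : tilt_mean l < tilt_mean l' -> l < l'.
Proof. by move=> h; rewrite ltNge; apply/negP => /tilt_mean_le; rewrite leNgt h. Qed.

Lemma continuous_tilt_mean : continuous tilt_mean.
Proof.
have cexp i : continuous (fun l : R => expR (l * x i)).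
  move=> l; apply: continuous_comp; last exact: continuous_expR.
  exact: mulrr_continuous.
have cZ : continuous Z.
  by move=> l; apply: cvg_big => [|i _]; first exact: add_continuous; apply: cexp.
rewrite (_ : tilt_mean = fun l =>
   \sum_(i in C) expR (l * x i) * (Z l)^-1 * x i); last first.
  by apply/funext => l; rewrite tilt_meanE; apply: eq_bigr => i _; rewrite tiltE.
move=> l; apply: cvg_big => [|i _]; first exact: add_continuous; apply: cvgM; last exact: cvg_cst.
apply: cvgM; first exact: cexp.
by apply: cvgV; [exact/lt0r_neq0/partition_fun_gt0|exact: cZ].
Qed.

Lemma exists_tilt t : tilt_mean 0 <= t <= tilt_mean 1 ->
  exists2 l, 0 <= l <= 1 & tilt_mean l = t.
Proof.
move=> /andP[h0 h1].
have [] := @IVT R tilt_mean 0 1 t ler01.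
- exact/continuous_subspaceT/continuous_tilt_mean.
- by rewrite ge_min h0 le_max h1 orbT.
by move=> l; rewrite in_itv /= => l01 <-; exists l.
Qed.

Lemma logmgf_ge l : 0 <= l <= 1 -> - (`|tilt_mean 0|) <= logmgf l.
Proof.
move=> /andP[l0 l1]; apply: le_trans (logmgf_tangent 0 l).
rewrite logmgf0 add0r subr0 lerNl -mulrN.
apply: (le_trans (ler_norm _)); rewrite normrM normrN ger0_norm //.
by rewrite -[leRHS]mul1r ler_wpM2r.
Qed.

Lemma legendre01_has_sup t : has_sup [set l * t - logmgf l | l in `[0%R, 1%R]].
Proof.
split; first by exists (0 * t - logmgf 0), 0 => //=; rewrite in_itv /= lexx ler01.
exists (`|t| + `|tilt_mean 0|) => y [l /=]; rewrite in_itv /= => l01 <-.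
apply: lerD; last by rewrite lerNl logmgf_ge.
apply: (le_trans (ler_norm _)); rewrite normrM.
by case/andP: l01 => l0 l1; rewrite ger0_norm // -[leRHS]mul1r ler_wpM2r.
Qed.

Lemma legendre01_ge t l : 0 <= l <= 1 -> l * t - logmgf l <= J t.
Proof.
move=> l01; rewrite legendre01.unlock; apply: ub_le_sup; first by case: (legendre01_has_sup t).
by exists l => //=; rewrite in_itv.
Qed.

Lemma legendre01_le t b : (forall l, 0 <= l <= 1 -> l * t - logmgf l <= b) ->
  J t <= b.
Proof.
move=> h; rewrite legendre01.unlock; apply: ge_sup; first by case: (legendre01_has_sup t).
by move=> y [l /=]; rewrite in_itv /= => l01 <-; apply: h.
Qed.

(** A tangent line of a convex function lies below it, so the supremum at a
    tilted mean is attained at the tilting slope. *)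
Lemma legendre01_tilt l : 0 <= l <= 1 -> J (tilt_mean l) = l * tilt_mean l - logmgf l.
Proof.
move=> l01; apply/eqP; rewrite eq_le legendre01_ge // andbT.
apply: legendre01_le => l' _; have := logmgf_tangent l l'; lra.
Qed.

Lemma legendre01_mean0 : J (tilt_mean 0) = 0.
Proof. by rewrite legendre01_tilt ?lexx ?ler01 // mul0r logmgf0 subr0. Qed.

Lemma legendre01_mean1 : J (tilt_mean 1) = tilt_mean 1 - logmgf 1.
Proof. by rewrite legendre01_tilt ?lexx ?ler01 // mul1r. Qed.

Lemma legendre01_nondecr t u : t <= u -> J t <= J u.
Proof.
move=> tu; apply: legendre01_le => l l01; apply: le_trans (legendre01_ge u l01).
by rewrite lerD2r ler_wpM2l //; case/andP: l01.
Qed.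

Lemma legendre01_lipschitz t u : t <= u -> J u <= J t + (u - t).
Proof.
move=> tu; apply: legendre01_le => l l01.
have := legendre01_ge t l01; case/andP: l01 => l0 l1.
have : l * (u - t) <= u - t by rewrite ler_piMl ?subr_ge0.
lra.
Qed.

Lemma continuous_legendre01 : continuous J.
Proof.
move=> t; apply/cvgrPdist_le => /= e e0; near=> u.
apply: (@le_trans _ _ `|t - u|); last by near: u; apply: cvgr_dist_le.
have [tu|/ltW ut] := leP t u.
  rewrite distrC ger0_norm ?subr_ge0 ?legendre01_nondecr //.
  rewrite distrC ger0_norm ?subr_ge0 //.
  by rewrite lerBlDl legendre01_lipschitz.
rewrite ger0_norm ?subr_ge0 ?legendre01_nondecr // ger0_norm ?subr_ge0 //.
by rewrite lerBlDl legendre01_lipschitz.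
Unshelve. all: by end_near. Qed.

(** Between [t] and [u] there is the mean of a positive tilt, and the
    corresponding line has positive slope. *)
Lemma legendre01_lt t u : tilt_mean 0 <= t -> t < u -> t < tilt_mean 1 -> J t < J u.
Proof.
move=> h0 tu h1.
pose v := (t + Num.min u (tilt_mean 1)) / 2.
have tm : t < Num.min u (tilt_mean 1) by rewrite lt_min tu h1.
have tv : t < v by rewrite /v; lra.
have vm : v < Num.min u (tilt_mean 1) by rewrite /v; lra.
move: (vm); rewrite lt_min => /andP[vu v1].
have [|l l01 lv] := @exists_tilt v; first by rewrite (ltW v1) (le_trans h0 (ltW tv)).
have l0 : 0 < l by apply: tilt_mean_lt_inv; rewrite lv (le_lt_trans h0).
apply: (le_lt_trans (legendre01_nondecr (ltW tv))).
apply: lt_le_trans (legendre01_ge u l01).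
by rewrite -lv legendre01_tilt // ltrD2r ltr_pM2l // lv.
Qed.

Lemma logmgf1_le_mean1 : logmgf 1 <= tilt_mean 1.
Proof. have := logmgf_tangent 1 0; rewrite logmgf0; lra. Qed.

Lemma tilt0 i : tilt 0 i = #|C|%:R^-1.
Proof. by rewrite /tilt mul0r logmgf0 subr0 expR0 mul1r. Qed.

(** Jensen's inequality is strict, since [1 + y < exp y] for [y != 0]. *)
Lemma mean0_lt_logmgf1 : ~ {in C &, forall i j, x i = x j} ->
  tilt_mean 0 < logmgf 1.
Proof.
move=> nonconst.
have [i iC xi] : exists2 i, i \in C & x i != tilt_mean 0.
  apply: contrapT => h; apply: nonconst => i j iC jC.
  have e k : k \in C -> x k = tilt_mean 0.
    by move=> kC; apply: contrapT => /eqP hk; apply: h; exists k.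
  by rewrite !e.
rewrite -ltr_expR expR_logmgf ltr_pdivlMr ?cardC_gt0 //.
rewrite /partition_fun.
have -> : expR (tilt_mean 0) * #|C|%:R =
   \sum_(k in C) expR (tilt_mean 0) * (1 + (x k - tilt_mean 0)).
  have s0 : \sum_(k in C) (x k - tilt_mean 0) = 0.
    apply: (@mulfI _ (#|C|%:R^-1)); first by rewrite invr_eq0 gt_eqF ?cardC_gt0.
    rewrite mulr0 mulr_sumr -[RHS](sum_tilt_centred 0).
    by apply: eq_bigr => k _; rewrite tilt0.
  by rewrite -mulr_sumr big_split /= s0 addr0 sumr_const.
rewrite (bigD1 i) // [ltRHS](bigD1 i) //=; apply: ltr_leD.
  rewrite mul1r -[in ltRHS](subrK (tilt_mean 0) (x i)) (addrC (_ - _)) expRD.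
  by rewrite ltr_pM2l ?expR_gt0 // expR_gt1Dx // subr_eq0.
apply: ler_sum => k _.
rewrite mul1r -[in leRHS](subrK (tilt_mean 0) (x k)) (addrC (_ - _)) expRD.
by rewrite ler_pM2l ?expR_gt0 // expR_ge1Dx.
Qed.

End LogMoment.

(** * The equation for the dimension *)

Section Exponent.
Variables (R : realType) (I : finType) (C : {set I}) (x : I -> R).
Hypothesis C_neq0 : C != finset.set0.
Hypothesis nonconst : ~ {in C &, forall i j, x i = x j}.
Variable g : R.
Hypothesis g_gt1 : 1 < g.

Local Notation J := (legendre01 C x).
Local Notation mean := (tilt_mean C x).
Local Notation Lam1 := (logmgf C x 1).

(** The sequence [t_j] of slopes, with [legendre01] for the rate function, the
    first slope [u] for the variable [s], and with [t_0] such that [t_1] is [u]. *)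
Definition slope (u : R) (j : nat) : R := iter j (fun v => u + g * J v) (mean 0).

(** The growth exponent of the least cost of a cover, where [r] stands for
    [1 / (theta * g^l)] and [l.+1] for the number of blocks. The last two terms
    are the rates of the two blocks that meet the columns between [K] and
    [g * K]. *)
Definition exponent (r : R) (l : nat) (u : R) : R :=
  Lam1 - u - (r - 1) * J (slope u l.+1) - (g - r) * J (slope u l).

Let g_gt0 : 0 < g. Proof. exact: lt_trans g_gt1. Qed.
Let mean0_lt_Lam1 : mean 0 < Lam1.
Proof. exact: mean0_lt_logmgf1. Qed.
Let Lam1_le_mean1 : Lam1 <= mean 1.
Proof. exact: logmgf1_le_mean1. Qed.

Lemma slope0 u : slope u 0 = mean 0.
Proof. by []. Qed.

Lemma slopeS u j : slope u j.+1 = u + g * J (slope u j).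
Proof. by []. Qed.

Lemma slope1 u : slope u 1 = u.
Proof. by rewrite slopeS slope0 legendre01_mean0 // mulr0 addr0. Qed.

Lemma slope_le u u' j : u <= u' -> slope u j <= slope u' j.
Proof.
move=> uu'; elim: j => [|j IH]; first by rewrite !slope0.
rewrite !slopeS lerD //.
by rewrite ler_pM2l // legendre01_nondecr.
Qed.

Lemma slope_nondecr u j : mean 0 <= u -> slope u j <= slope u j.+1.
Proof.
move=> mu; elim: j => [|j IH]; first by rewrite slope1 slope0.
by rewrite (slopeS u j) (slopeS u j.+1) lerD2l ler_pM2l // legendre01_nondecr.
Qed.

Lemma slope_mono u i j : mean 0 <= u -> (i <= j)%N -> slope u i <= slope u j.
Proof.
move=> mu; elim: j => [|j IH]; first by rewrite leqn0 => /eqP ->.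
rewrite leq_eqVlt => /predU1P[-> //|]; rewrite ltnS => /IH h.
exact: le_trans h (slope_nondecr _ mu).
Qed.

Lemma mean0_le_slope u j : mean 0 <= u -> mean 0 <= slope u j.
Proof. by move=> mu; rewrite -(slope0 u); apply: slope_mono. Qed.

Lemma continuous_slope j : continuous (slope^~ j).
Proof.
elim: j => [|j IH] u.
  under [X in continuous_at _ X]eq_fun do rewrite slope0.
  exact: cvg_cst.
under [X in continuous_at _ X]eq_fun do rewrite slopeS.
apply: cvgD; first exact: cvg_id.
apply: cvgM; first exact: cvg_cst.
by apply: continuous_comp; [exact: IH|exact: continuous_legendre01].
Qed.

Lemma continuous_exponent r l : continuous (exponent r l).
Proof.
have cJ j : continuous (fun u => J (slope u j)).
  by move=> u; apply: continuous_comp; [exact: continuous_slope|exact: continuous_legendre01].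
move=> u; apply: cvgB.
  apply: cvgB; first by apply: cvgB; [exact: cvg_cst|exact: cvg_id].
  by apply: cvgM; [exact: cvg_cst|exact: cJ].
by apply: cvgM; [exact: cvg_cst|exact: cJ].
Qed.

Lemma exponent_decr r l u u' : 1 <= r < g -> u < u' ->
  exponent r l u' < exponent r l u.
Proof.
move=> /andP[r1 rg] uu'.
have h1 : (r - 1) * J (slope u l.+1) <= (r - 1) * J (slope u' l.+1).
  by rewrite ler_wpM2l ?subr_ge0 // legendre01_nondecr // slope_le // ltW.
have h2 : (g - r) * J (slope u l) <= (g - r) * J (slope u' l).
  by rewrite ler_pM2l ?subr_gt0 // legendre01_nondecr // slope_le // ltW.
rewrite /exponent; lra.
Qed.

(** The slopes stay in the range of the tilted means: as [u + (g - 1) * J t]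
    is at most [Lam1] for all the slopes [t] before the last one, the next
    slope is at most [Lam1 + J (mean 1)], which is [mean 1]. *)
Lemma slope_le_mean1 r l u j : 1 <= r < g -> mean 0 <= u ->
  0 <= exponent r l u -> (j <= l.+1)%N -> slope u j <= mean 1.
Proof.
move=> /andP[r1 rg] mu e0; elim: j => [_|j IH jl].
  rewrite slope0; exact: ltW (lt_le_trans mean0_lt_Lam1 Lam1_le_mean1).
have {}IH := IH (ltnW jl).
have J1 : J (slope u j) <= mean 1 - Lam1.
  by rewrite -legendre01_mean1 // legendre01_nondecr.
have h1 : (r - 1) * J (slope u j) <= (r - 1) * J (slope u l.+1).
  rewrite ler_wpM2l ?subr_ge0 // legendre01_nondecr // slope_mono //.
  exact: ltnW.
have h2 : (g - r) * J (slope u j) <= (g - r) * J (slope u l).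
  by rewrite ler_pM2l ?subr_gt0 // legendre01_nondecr // slope_mono.
have h3 : (r - 1) * J (slope u j) + (g - r) * J (slope u j) =
  g * J (slope u j) - J (slope u j) by ring.
rewrite slopeS; move: e0; rewrite /exponent; lra.
Qed.

Lemma slope_lt l u j : mean 0 < u ->
  (forall j, (j <= l)%N -> slope u j <= mean 1) -> (j <= l)%N ->
  slope u j < slope u j.+1.
Proof.
move=> mu h; elim: j => [_|j IH jl]; first by rewrite slope1 slope0.
have {}IH := IH (ltnW jl).
rewrite (slopeS u j) (slopeS u j.+1) ltrD2l ltr_pM2l //.
apply: legendre01_lt => //; first exact/mean0_le_slope/ltW.
exact: lt_le_trans IH (h _ jl).
Qed.

Lemma exists_exponent_root r l : 1 <= r < g -> ((l == 0%N) ==> (1 < r)) ->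
  exists u, [/\ mean 0 < u, u < Lam1 & exponent r l u = 0].
Proof.
move=> rg; have /andP[r1 r2] := rg => lr.
have e0 : 0 < exponent r l (mean 0).
  have s j : slope (mean 0) j = mean 0.
    by elim: j => [|j IH]; rewrite ?slope0 // slopeS IH legendre01_mean0 // mulr0 addr0.
  by rewrite /exponent !s legendre01_mean0 // !mulr0 !subr0 subr_gt0.
have JLam j : 0 < J (slope Lam1 j.+1).
  apply: (@lt_le_trans _ _ (J Lam1)); last first.
    rewrite legendre01_nondecr // -{1}(slope1 Lam1) slope_mono //; exact: ltW.
  rewrite -(legendre01_mean0 x C_neq0) legendre01_lt //.
  exact: lt_le_trans mean0_lt_Lam1 Lam1_le_mean1.
have e1 : exponent r l Lam1 < 0.
  rewrite /exponent subrr sub0r -opprD oppr_lt0.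
  case: l lr {e0} => [r1'|l _].
    by rewrite slope0 legendre01_mean0 // mulr0 addr0 mulr_gt0 // subr_gt0.
  apply: ltr_wpDl; last by rewrite mulr_gt0 // subr_gt0.
  by rewrite mulr_ge0 ?subr_ge0 // ltW.
have [] := @IVT R (exponent r l) (mean 0) Lam1 0 (ltW mean0_lt_Lam1).
- exact/continuous_subspaceT/continuous_exponent.
- by rewrite ge_min (ltW e1) orbT le_max (ltW e0).
move=> u; rewrite in_itv /= => /andP[u0 u1] eu; exists u; split => //.
- by rewrite lt_neqAle u0 andbT; apply: contraTneq e0 => ->; rewrite eu ltxx.
- by rewrite lt_neqAle u1 andbT; apply: contraTneq e1 => <-; rewrite eu ltxx.
Qed.

(** The passage from [theta] to [theta / g] increases the number of blocks by
    one and keeps [r]. *)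
Lemma exponent_succ_lt r l u : 1 <= r < g -> mean 0 < u ->
  exponent r l u = 0 -> exponent r l.+1 u < 0.
Proof.
move=> rg mu e0; have /andP[r1 r2] := rg.
have le1 j : (j <= l.+1)%N -> slope u j <= mean 1.
  by apply: (slope_le_mean1 (r := r)); rewrite ?e0 // ltW.
have lt1 : slope u l < slope u l.+1.
  by apply: (@slope_lt l.+1).
have J1 : J (slope u l) < J (slope u l.+1).
  apply: legendre01_lt => //; first exact/mean0_le_slope/ltW.
  exact: lt_le_trans lt1 (le1 _ _).
have J2 : J (slope u l.+1) <= J (slope u l.+2).
  by rewrite legendre01_nondecr // slope_nondecr // ltW.
have h1 : (r - 1) * J (slope u l.+1) <= (r - 1) * J (slope u l.+2).
  by rewrite ler_wpM2l ?subr_ge0.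
have h2 : (g - r) * J (slope u l) < (g - r) * J (slope u l.+1).
  by rewrite ltr_pM2l ?subr_gt0.
move: e0; rewrite /exponent; lra.
Qed.

End Exponent.

(** * Product measures on codes *)

Section Words.
Variables (R : realType) (m n : nat) (A : {set 'I_m * 'I_n}).
Hypothesis A_neq0 : A != finset.set0.

Local Notation letter := ('I_m * 'I_n)%type.

Definition log_size (i : 'I_m) : R := ln (column_size A i)%:R.

Local Notation C := (columns A).
Local Notation x := log_size.
Local Notation tiltC := (tilt C x).
Local Notation meanC := (tilt_mean C x).
Local Notation Lam := (logmgf C x).

Lemma columns_neq0 : C != finset.set0.
Proof.
have /set0Pn [a aA] := A_neq0.
by apply/set0Pn; exists a.1; apply: imset_f.
Qed.

Lemma letter_column a : a \in A -> a.1 \in C.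
Proof. by move=> aA; apply: imset_f. Qed.

Lemma column_size_gt0 i : i \in C -> (0 < column_size A i)%N.
Proof.
move=> /imsetP [[i' j] aA ->] /=; apply/card_gt0P; exists j.
by rewrite inE.
Qed.

Lemma expR_log_size i : i \in C -> expR (x i) = (column_size A i)%:R.
Proof. by move=> iC; rewrite lnK // posrE ltr0n column_size_gt0. Qed.

Lemma sum_letters (F : letter -> R) :
  \sum_(a in A) F a = \sum_(i in C) \sum_(j | (i, j) \in A) F (i, j).
Proof.
rewrite pair_big_dep /=; apply: eq_big; last by case.
move=> [i j] /=; apply/idP/andP => [h|[]//]; split => //.
exact: (letter_column h).
Qed.

(** The sum over a column cancels the equidistribution in the column. *)
Lemma sum_letters_column (f : 'I_m -> R) :
  \sum_(a in A) f a.1 / expR (x a.1) = \sum_(i in C) f i.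
Proof.
rewrite sum_letters; apply: eq_bigr => i iC /=.
rewrite sumr_const expR_log_size //.
have -> : #|[pred j | (i, j) \in A]| = column_size A i.
  by apply: eq_card => j; rewrite !inE.
by rewrite -[LHS]mulr_natr divfK // pnatr_eq0 -lt0n column_size_gt0.
Qed.

(** Within its column a letter is equidistributed. *)
Definition letter_mass (l : R) (a : letter) : R :=
  if a \in A then tiltC l a.1 / expR (x a.1) else 0.

Lemma letter_mass_ge0 l a : 0 <= letter_mass l a.
Proof.
rewrite /letter_mass; case: ifP => // _.
by rewrite divr_ge0 ?expR_ge0 // ltW // tilt_gt0 // columns_neq0.
Qed.

Lemma sum_letter_mass l (f : letter -> R) :
  \sum_a letter_mass l a * f a =
  \sum_(a in A) (tiltC l a.1 / expR (x a.1)) * f a.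
Proof.
rewrite [RHS]big_mkcond /=; apply: eq_bigr => a _; rewrite /letter_mass.
by case: ifP => // _; rewrite mul0r.
Qed.

Lemma sum_letter_mass_column l (f : 'I_m -> R) :
  \sum_a letter_mass l a * f a.1 = \sum_(i in C) tiltC l i * f i.
Proof.
rewrite sum_letter_mass -sum_letters_column; apply: eq_bigr => a _.
by rewrite mulrAC.
Qed.

Lemma sum_letter_mass1 l : \sum_a letter_mass l a = 1.
Proof.
rewrite -(sum_tilt x columns_neq0 l).
transitivity (\sum_a letter_mass l a * (fun=> 1) a.1).
  by apply: eq_bigr => a _; rewrite mulr1.
by rewrite (sum_letter_mass_column l (fun=> 1)); apply: eq_bigr => i _; rewrite mulr1.
Qed.

Section Mass.
Variables (D : nat) (lam : nat -> R).

Local Notation word := {ffun 'I_D.+1 -> letter}.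

Definition digits (w : word) (q : nat) : letter := w (inord q).

Lemma digitsE (w : word) (q : 'I_D.+1) : digits w q = w q.
Proof. by rewrite /digits inord_val. Qed.

Definition word_mass (w : word) : R := \prod_(q < D.+1) letter_mass (lam q) (w q).

Lemma word_mass_ge0 w : 0 <= word_mass w.
Proof. by apply: prodr_ge0 => q _; apply: letter_mass_ge0. Qed.

Lemma expectation_prod (f : nat -> letter -> R) :
  \sum_w word_mass w * \prod_(q < D.+1) f q (w q) =
  \prod_(q < D.+1) \sum_a letter_mass (lam q) a * f q a.
Proof.
rewrite bigA_distr_bigA /=; apply: eq_bigr => w _.
by rewrite /word_mass -big_split.
Qed.

Lemma sum_word_mass : \sum_w word_mass w = 1.
Proof.
rewrite /word_mass -(bigA_distr_bigA (fun q : 'I_D.+1 => letter_mass (lam q))).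
by rewrite big1 // => q _; apply: sum_letter_mass1.
Qed.

Lemma word_mass_neq0 w q : word_mass w != 0 -> digits w q \in A.
Proof.
move=> h; rewrite /digits; move: (inord q) => {}q.
apply: contraNT h => qA; rewrite /word_mass (bigD1 q) //=.
by rewrite /letter_mass (negbTE qA) mul0r.
Qed.

End Mass.

(** The value of the first [l] digits as a base-[b] numeral. For the columns of
    a code and [b = m] it is the index of the strip of width [m^-l] that contains
    the coded point. *)
Fixpoint prefix_value (b : nat) (d : nat -> nat) (l : nat) : nat :=
  if l is l'.+1 then (prefix_value b d l' * b + d l')%N else 0%N.

Lemma prefix_value_inj b d d' l : (forall q, d q < b)%N -> (forall q, d' q < b)%N ->
  (prefix_value b d l = prefix_value b d' l) <-> (forall q, (q < l)%N -> d q = d' q).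
Proof.
move=> db db'; elim: l => [|l IH] //=.
have b0 : (0 < b)%N by apply: leq_ltn_trans (db 0%N).
split=> [e q|h].
  have e1 := congr1 (divn^~ b) e; have e2 := congr1 (modn^~ b) e.
  move: e1 e2; rewrite /= !divnMDl // !divn_small // !addn0 !modnMDl !modn_small //.
  by move=> /IH h1 h2; rewrite ltnS leq_eqVlt => /predU1P[-> //|/h1].
by rewrite (h l) // (proj2 IH) // => q ql; apply: h; apply: ltnW.
Qed.

(** The position of an approximate square in the grid. *)
Definition cell (l k : nat) (w : nat -> letter) : nat * nat :=
  (prefix_value m (fun q => (w q).1) l, prefix_value n (fun q => (w q).2) k).

Lemma cell_eqP l k w w' : reflect
  ((forall q, (q < l)%N -> (w q).1 = (w' q).1) /\
   (forall q, (q < k)%N -> (w q).2 = (w' q).2)) (cell l k w == cell l k w').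
Proof.
have e1 := @prefix_value_inj m (fun q => (w q).1) (fun q => (w' q).1) l
   (fun q => ltn_ord _) (fun q => ltn_ord _).
have e2 := @prefix_value_inj n (fun q => (w q).2) (fun q => (w' q).2) k
   (fun q => ltn_ord _) (fun q => ltn_ord _).
apply: (iffP eqP) => [[/e1 h1 /e2 h2]|[h1 h2]].
  by split=> q ql; apply: val_inj; [apply: h1|apply: h2].
by congr (_, _); [apply/e1|apply/e2] => q ql; rewrite ?h1 ?h2.
Qed.

Definition log_cell_mass (lam : nat -> R) (l k : nat) (w : nat -> letter) : R :=
  \sum_(q < l) (lam q * x (w q).1 - Lam (lam q) - ln #|C|%:R) -
  \sum_(q < k) x (w q).1.

(** The rows are equidistributed in their columns, so [k] complete letters
    followed by the columns of [l - k] more letters have the mass below. *)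
Lemma cell_mass D lam l k (w0 : nat -> letter) :
  (k <= l)%N -> (l <= D.+1)%N -> (forall q, (q < l)%N -> w0 q \in A) ->
  \sum_(w : {ffun 'I_D.+1 -> letter} | cell l k (digits w) == cell l k w0)
    word_mass lam w = expR (log_cell_mass lam l k w0).
Proof.
move=> kl lD w0A.
pose agree q (a : letter) : bool :=
  ((q < l)%N ==> (a.1 == (w0 q).1)) && ((q < k)%N ==> (a.2 == (w0 q).2)).
have agreeP (w : {ffun 'I_D.+1 -> letter}) :
  (cell l k (digits w) == cell l k w0)%:R = \prod_(q < D.+1) (agree q (w q))%:R :> R.
  case: cell_eqP => [[h1 h2]|h].
    rewrite big1 // => q _; rewrite /agree -digitsE.
    have -> : (q < l)%N ==> ((digits w q).1 == (w0 q).1) by apply/implyP => /h1 ->.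
    by have -> : (q < k)%N ==> ((digits w q).2 == (w0 q).2) by apply/implyP => /h2 ->.
  suff [q hq] : exists q : 'I_D.+1, agree q (w q) = false.
    by rewrite (bigD1 q) //= hq mul0r.
  apply: contrapT => h'; apply: h.
  have ag q : (q < l)%N -> agree q (digits w q).
    move=> ql; have qD : (q < D.+1)%N by apply: leq_trans ql lD.
    apply: contrapT => /negP/negbTE h; apply: h'; exists (Ordinal qD).
    by rewrite -digitsE.
  split=> q ql; first by have := ag q ql; rewrite /agree ql /= => /andP[/eqP].
  have := ag q (leq_trans ql kl); rewrite /agree ql /= => /andP[_].
  by move/eqP.
rewrite big_mkcond /=.
under eq_bigr do rewrite -mulrb -mulr_natr agreeP.
transitivity (\sum_(w : {ffun 'I_D.+1 -> letter})
  word_mass lam w * \prod_(q < D.+1) (agree q (w q))%:R).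
  by [].
rewrite (expectation_prod D lam (fun q a => (agree q a)%:R)).
pose e q := (if (q < l)%N then lam q * x (w0 q).1 - Lam (lam q) - ln #|C|%:R else 0)
   - (if (q < k)%N then x (w0 q).1 else 0).
transitivity (\prod_(q < D.+1) expR (e q)).
  apply: eq_bigr => q _; rewrite sum_letter_mass.
  have tE i : tiltC (lam q) i = expR (lam q * x i - Lam (lam q) - ln #|C|%:R).
    by rewrite /tilt [RHS]expRB lnK // posrE cardC_gt0 // columns_neq0.
  rewrite /agree /e; have [qk|kq] := ltnP q k.
    rewrite (leq_trans qk kl) /= (bigD1 (w0 q)) ?w0A ?(leq_trans qk kl) //=.
    rewrite !eqxx mulr1 [RHS]expRB -tE big1 ?addr0 // => a /andP[_ neq].
    suff -> : (a.1 == (w0 q).1) && (a.2 == (w0 q).2) = false by rewrite mulr0.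
    by apply: contraNF neq => /andP[/eqP h1 /eqP h2]; case: a (w0 q) h1 h2 => [? ?] [? ?] /= -> ->.
  have [ql|lq] := ltnP q l; rewrite /= subr0.
    rewrite -tE.
    transitivity (\sum_(a in A) (tiltC (lam q) a.1 * (a.1 == (w0 q).1)%:R) / expR (x a.1)).
      by apply: eq_bigr => a _; rewrite andbT mulrAC.
    rewrite (sum_letters_column (fun i => tiltC (lam q) i * (i == (w0 q).1)%:R)).
    rewrite (bigD1 (w0 q).1) ?letter_column ?w0A //= eqxx mulr1.
    by rewrite big1 ?addr0 // => i /andP[_ /negbTE ->]; rewrite mulr0.
  rewrite expR0; under eq_bigr do rewrite mulr1.
  by rewrite sum_letters_column sum_tilt // columns_neq0.
rewrite -expR_sum; congr expR; rewrite sumrB /log_cell_mass.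
congr (_ - _).
  rewrite (big_ord_widen _ (fun q => lam q * x (w0 q).1 - Lam (lam q) - ln #|C|%:R) lD).
  by rewrite [RHS]big_mkcond.
rewrite (big_ord_widen _ (fun q => x (w0 q).1) (leq_trans kl lD)).
by rewrite [RHS]big_mkcond.
Qed.

End Words.

(** * Deviations *)

Section Chernoff.
Variables (R : realType) (m n : nat) (A : {set 'I_m * 'I_n}).
Hypothesis A_neq0 : A != finset.set0.

Local Notation letter := ('I_m * 'I_n)%type.
Local Notation C := (columns A).
Local Notation x := (log_size R A).
Local Notation tiltC := (tilt C x).
Local Notation meanC := (tilt_mean C x).

Lemma log_size_ge0 i : 0 <= x i.
Proof.
rewrite /log_size; case: (column_size A i) => [|k]; first by rewrite ln0.
by rewrite ln_ge0 // ler1n.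
Qed.

Lemma log_size_le i : i \in C -> x i <= ln n%:R.
Proof.
move=> iC; rewrite /log_size; have s0 := column_size_gt0 iC.
have sn : (column_size A i <= n)%N.
  by rewrite -[leqRHS]card_ord; apply: max_card.
by rewrite ler_ln ?ler_nat // posrE ltr0n // (leq_trans s0).
Qed.

Lemma tilt_mean_bounds l : 0 <= meanC l <= ln n%:R.
Proof.
have C0 := columns_neq0 A_neq0; rewrite tilt_meanE.
apply/andP; split.
  by apply: sumr_ge0 => i _; rewrite mulr_ge0 ?log_size_ge0 // ltW // tilt_gt0.
apply: (@le_trans _ _ (\sum_(i in C) tiltC l i * ln n%:R)).
  apply: ler_sum => i iC; rewrite ler_wpM2l ?log_size_le //.
  exact/ltW/tilt_gt0.
by rewrite -mulr_suml sum_tilt // mul1r.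
Qed.

Lemma log_size_centred_le l i : i \in C -> `|x i - meanC l| <= ln n%:R.
Proof.
move=> iC; have := tilt_mean_bounds l; have := log_size_le iC.
have := log_size_ge0 i; rewrite ler_norml; lra.
Qed.

Lemma expR_le_quadratic (y : R) : y <= 2^-1 -> expR y <= 1 + y + 2 * y ^+ 2.
Proof.
move=> y2; have h := expR_ge1Dx (- y).
have p : 0 < 1 - y by lra.
rewrite -[expR y]invrK -expRN; apply: (@le_trans _ _ (1 - y)^-1).
  by rewrite lef_pV2 ?posrE ?expR_gt0.
rewrite -div1r ler_pdivrMr //.
have -> : (1 + y + 2 * y ^+ 2) * (1 - y) = 1 + y ^+ 2 * (1 - 2 * y) by ring.
by rewrite lerDl mulr_ge0 ?sqr_ge0 //; lra.
Qed.

Variables (D : nat) (lam : nat -> R).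

Definition deviation (c : nat -> R) (w : {ffun 'I_D.+1 -> letter}) : R :=
  \sum_(q < D.+1) c q * (x (digits w q).1 - meanC (lam q)).

(** The exponential moment method: each factor of the moment generating
    function is at most [1 + 2 * (eta * ln n)^2], as the variables are centred
    and bounded by [ln n]. *)
Lemma chernoff (c : nat -> R) (b : nat) (eta a : R) :
  (forall q, `|c q| <= 1) -> (forall q, (b <= q)%N -> c q = 0) ->
  0 <= eta -> eta * ln n%:R <= 2^-1 ->
  \sum_(w | deviation c w <= - a) word_mass A lam w <=
  expR (2 * (eta * ln n%:R) ^+ 2 * b%:R - eta * a).
Proof.
move=> c1 c0 eta0 etaB.
pose f q (e : letter) : R := expR (- eta * (c q * (x e.1 - meanC (lam q)))).
apply: (@le_trans _ _ (\sum_w word_mass A lam w *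
   (\prod_(q < D.+1) f q (w q)) * expR (- eta * a))).
  rewrite big_mkcond; apply: ler_sum => w _.
  have m0 := word_mass_ge0 A_neq0 lam w.
  case: ifP => [h|_]; last first.
    by rewrite !mulr_ge0 ?expR_ge0 // prodr_ge0 // => q _; apply: expR_ge0.
  rewrite -mulrA -[leLHS]mulr1 ler_wpM2l // /f -expR_sum -expRD -expR0 ler_expR.
  have -> : \sum_(q < D.+1) - eta * (c q * (x (w q).1 - meanC (lam q))) =
     - eta * deviation c w.
    by rewrite /deviation mulr_sumr; apply: eq_bigr => q _; rewrite digitsE.
  rewrite -mulrDr mulNr -mulrN mulr_ge0 //; lra.
rewrite -mulr_suml expectation_prod expRD -mulNr ler_wpM2r ?expR_ge0 //.
apply: (@le_trans _ _ (\prod_(q < D.+1)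
    expR (2 * (eta * ln n%:R) ^+ 2 * (q < b)%:R))); last first.
  rewrite -expR_sum ler_expR -mulr_sumr ler_wpM2l //.
    by rewrite mulr_ge0 ?sqr_ge0.
  rewrite -natr_sum ler_nat.
  have -> : (\sum_(q < D.+1) (q < b) = minn D.+1 b)%N.
    by elim: D.+1 => [|a' IH]; rewrite ?big_ord0 ?min0n // big_ord_recr /= IH; lia.
  exact: geq_minr.
apply: ler_prod => q _; apply/andP; split.
  by apply: sumr_ge0 => e _; rewrite mulr_ge0 ?expR_ge0 // letter_mass_ge0.
rewrite (sum_letter_mass_column A (lam q)
   (fun i => expR (- eta * (c q * (x i - meanC (lam q)))))).
have C0 := columns_neq0 A_neq0.
have [qb|bq] := ltnP q b; last first.
  under eq_bigr do rewrite c0 // mul0r mulr0 expR0 mulr1.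
  by rewrite sum_tilt // mulr0 expR0.
rewrite mulr1.
apply: (@le_trans _ _ (\sum_(i in C) tiltC (lam q) i *
  (1 - eta * c q * (x i - meanC (lam q)) + 2 * (eta * ln n%:R) ^+ 2))).
  apply: ler_sum => i iC; rewrite ler_wpM2l ?(ltW (tilt_gt0 _ _ _ _)) //.
  set y := - eta * _.
  have yB : `|y| <= eta * ln n%:R.
    rewrite /y normrM normrN (ger0_norm eta0) ler_wpM2l // normrM.
    by rewrite -[leRHS]mul1r ler_pM // log_size_centred_le.
  apply: le_trans (expR_le_quadratic _) _.
    by apply: le_trans (ler_norm _) (le_trans yB etaB).
  rewrite -mulrA -mulNr -/y lerD2l ler_pM2l // -real_normK ?num_real //.
  by rewrite lerXn2r ?nnegrE // (le_trans _ yB).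
set K := 2 * _ ^+ 2.
have -> : \sum_(i in C) tiltC (lam q) i *
    (1 - eta * c q * (x i - meanC (lam q)) + K) =
  \sum_(i in C) tiltC (lam q) i * (1 + K) -
  eta * c q * \sum_(i in C) tiltC (lam q) i * (x i - meanC (lam q)).
  by rewrite mulr_sumr -sumrB; apply: eq_bigr => i _; ring.
by rewrite sum_tilt_centred // mulr0 subr0 -mulr_suml sum_tilt // mul1r expR_ge1Dx.
Qed.

End Chernoff.

(** * Blocks of levels *)

Section Blocks.
Variables (R : realType) (c : nat -> nat) (N : nat).

(** For decreasing end points [c] the block of [q] is the number of the [c j]
    above [q], so that blocks are counted from the last one. *)
Definition block (q : nat) : nat := (\sum_(j < N) (q < c j))%N.

Hypothesis c_antitone : forall i j, (i <= j < N)%N -> (c j <= c i)%N.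

(** The increments of [f] along the blocks telescope. *)
Lemma block_step (f : nat -> R) q :
  f (block q) = f 0%N + \sum_(j < N) (f j.+1 - f j) * (q < c j)%:R.
Proof.
rewrite /block; elim: N c_antitone => [|M IH] anti.
  by rewrite !big_ord0 addr0.
rewrite !big_ord_recr /=.
have anti' i j : (i <= j < M)%N -> (c j <= c i)%N.
  by move=> /andP[ij jM]; apply: anti; rewrite ij /= ltnW.
case: ltnP => qc /=; last by rewrite addn0 mulr0 addr0 IH.
have all1 j : (j < M)%N -> (q < c j)%N.
  by move=> jM; apply: leq_trans qc (anti j M _); rewrite leqnn andbT ltnW.
have -> : (\sum_(j < M) (q < c j))%N = M.
  rewrite (eq_bigr (fun=> 1%N)); first by rewrite sum1_card card_ord.
  by move=> j _; rewrite all1.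
rewrite addn1 mulr1 (eq_bigr (fun j : 'I_M => f j.+1 - f j)); last first.
  by move=> j _; rewrite all1 // mulr1.
by rewrite -(big_mkord xpredT (fun j => f j.+1 - f j)) telescope_sumr //; ring.
Qed.

Lemma sum_indicator (v : nat -> R) (a b : nat) :
  \sum_(q < a) (q < b)%:R * v q = \sum_(q < minn a b) v q.
Proof.
rewrite (big_ord_widen a v (geq_minl a b)) [RHS]big_mkcond /=.
apply: eq_bigr => q _; rewrite leq_min ltn_ord /=.
by case: ltnP; rewrite ?mul1r ?mul0r.
Qed.

(** Summation by parts along the blocks. *)
Lemma sum_block (f v : nat -> R) (a : nat) :
  \sum_(q < a) f (block q) * v q = f 0%N * (\sum_(q < a) v q) +
    \sum_(j < N) (f j.+1 - f j) * \sum_(q < minn a (c j)) v q.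
Proof.
under eq_bigr do rewrite block_step mulrDl mulr_suml.
rewrite big_split /= -mulr_sumr exchange_big /=; congr (_ + _).
apply: eq_bigr => j _; rewrite -sum_indicator mulr_sumr.
by apply: eq_bigr => q _; rewrite mulrA.
Qed.

(** With nondecreasing tilts from 0 to 1, the tilted sum over [q < lev k] is a
    convex combination of partial sums of [d] at points of [[K, E]]; hence the
    point of that interval where the partial sum is least does the job. *)
Lemma exists_balanced_level (lamv : nat -> R) (lev : nat -> nat) (K E : nat)
    (d : nat -> R) :
  {homo lamv : i j / (i <= j)%N >-> i <= j} -> lamv 0%N = 0 -> lamv N = 1 ->
  (K <= E)%N -> (forall k, (k <= lev k)%N) ->
  (forall j, (j < N)%N -> (K <= c j <= E)%N) ->
  exists2 k, (K <= k <= E)%N &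
    \sum_(q < k) d q - \sum_(q < lev k) lamv (block q) * d q <= 0.
Proof.
move=> hom l0 lN KE levk cKE.
pose V k := \sum_(q < k) d q.
pose i0 : 'I_E.+1 := Ordinal (leqnn E.+1).
case: (@Order.TotalTheory.arg_minP _ _ 'I_E.+1 i0 (fun i => (K <= i)%N) (fun i => V i)) => //.
move=> k Kk kmin; exists k; first by rewrite Kk -ltnS ltn_ord.
have Vk j : (K <= j <= E)%N -> V k <= V j.
  by move=> /andP[Kj jE]; apply: (kmin (Ordinal (jE : (j < E.+1)%N))).
rewrite sum_block l0 mul0r add0r subr_le0.
have -> : \sum_(q < k) d q = \sum_(j < N) (lamv j.+1 - lamv j) * V k.
  rewrite -mulr_suml -(big_mkord xpredT (fun j => lamv j.+1 - lamv j)).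
  by rewrite telescope_sumr // lN l0 subr0 mul1r.
apply: ler_sum => j _; rewrite ler_wpM2l ?subr_ge0 ?hom //.
apply: Vk; have /andP[h1 h2] := cKE j (ltn_ord j).
by rewrite leq_min (leq_trans Kk) //= h1 (leq_trans (geq_minr _ _)).
Qed.

End Blocks.

Section Balance.
Variables (R : realType) (g r : R) (l : nat).
Hypotheses (g_gt1 : 1 < g) (r_ge1 : 1 <= r).
Variables (K E : nat).

(** The ends of the blocks: [E / g^j] for the first ones, then [K]. *)
Definition breakpoint (j : nat) : nat :=
  if (j <= l)%N then Num.truncn (E%:R / g ^+ j : R) else K.

Local Notation c := breakpoint.

Let g_gt0 : 0 < g. Proof. exact: lt_trans g_gt1. Qed.

Let gX_gt0 j : 0 < g ^+ j. Proof. exact: exprn_gt0. Qed.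

Hypothesis E_ge : r * K%:R * g ^+ l <= E%:R.

Lemma breakpoint0 : c 0 = E.
Proof. by rewrite /breakpoint /= expr0 divr1 natrK. Qed.

Lemma breakpoint_last : c l.+1 = K.
Proof. by rewrite /breakpoint ltnn. Qed.

Lemma breakpoint_itv j : (j <= l)%N ->
  (c j)%:R <= E%:R / g ^+ j /\ E%:R / g ^+ j < (c j)%:R + 1.
Proof.
move=> jl; rewrite /breakpoint jl.
have := @truncn_itv R (E%:R / g ^+ j); rewrite divr_ge0 ?(ltW (gX_gt0 _)) //.
by move=> /(_ isT)/andP[-> h]; rewrite natr1.
Qed.

Lemma breakpoint_antitone i j : (i <= j < l.+2)%N -> (c j <= c i)%N.
Proof.
move=> /andP[ij jl].
have geK i' : (i' <= l)%N -> (K <= c i')%N.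
  move=> il; rewrite /breakpoint il truncn_ge_nat; last first.
    by rewrite divr_ge0 // ltW.
  rewrite ler_pdivlMr ?gX_gt0 //; apply: le_trans E_ge.
  apply: (@le_trans _ _ (K%:R * g ^+ l)); last first.
    by rewrite -mulrA ler_peMl // mulr_ge0 // ltW.
  by rewrite ler_wpM2l // ler_weXn2l // ltW.
have [->//|ij'] := eqVneq i j.
have il : (i <= l)%N by lia.
case: (leqP j l) => jl'; last first.
  by rewrite [X in (X <= _)%N]/breakpoint (leqNgt j) jl' geK.
rewrite /breakpoint il jl' le_truncn // ler_wpM2l // lef_pV2 ?posrE //.
by rewrite ler_weXn2l // ltW.
Qed.

Lemma breakpoint_bounds j : (j < l.+2)%N -> (K <= c j <= E)%N.
Proof.
move=> jl; rewrite -[X in (X <= _ <= _)%N]breakpoint_last -breakpoint0.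
by rewrite !breakpoint_antitone ?leqnn ?andbT.
Qed.

Lemma leq_KE : (K <= E)%N.
Proof. by have /andP[h1 h2] := breakpoint_bounds (ltn0Sn _); apply: leq_trans h1 h2. Qed.

Variable lev : nat -> nat.
Hypothesis lev_itv : forall k, (lev k)%:R <= g * k%:R /\ g * k%:R < (lev k)%:R + 1.

Lemma minr_dist (a b a' b' e : R) : `|a - a'| <= e -> `|b - b'| <= e ->
  `|Num.min a b - Num.min a' b'| <= e.
Proof.
rewrite !ler_norml => /andP[h1 h2] /andP[h3 h4].
by rewrite /Num.min; case: ltP => ?; case: ltP => ?; apply/andP; split; lra.
Qed.

Lemma natr_min a b : (minn a b)%:R = Num.min a%:R b%:R :> R.
Proof.
rewrite /Num.min ltr_nat /minn; by case: ifP.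
Qed.

(** Multiplication by [g] takes levels to the columns known there, and each
    breakpoint to the preceding one. *)
Lemma min_level_dist k j : (j < l)%N ->
  `|g * (minn k (c j.+1))%:R - (minn (lev k) (c j))%:R| <= g.
Proof.
move=> jl; rewrite !natr_min minr_pMr ?(ltW g_gt0) //.
have [h1 h2] := lev_itv k.
have [h3 h4] := breakpoint_itv (ltnW jl).
have [h5 h6] := breakpoint_itv jl.
have e : E%:R / g ^+ j = g * (E%:R / g ^+ j.+1).
  by rewrite exprS invfM mulrCA mulVKf // gt_eqF.
have g1 := g_gt1.
apply: minr_dist; rewrite ler_norml; apply/andP; split.
- by lra.
- by lra.
- have : g * (c j.+1)%:R <= E%:R / g ^+ j by rewrite e ler_pM2l.
  have : E%:R / g ^+ j <= g * ((c j.+1)%:R + 1) by rewrite e ler_pM2l // ltW.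
  lra.
- have : g * (c j.+1)%:R <= E%:R / g ^+ j by rewrite e ler_pM2l.
  lra.
Qed.

Hypothesis r_lt_g : r < g.

Lemma last_level_dist k a : (K <= k)%N -> 0 <= a -> E%:R <= r * K%:R * g ^+ l + a ->
  `|r * K%:R - (minn (lev k) (c l))%:R| <= a + 1.
Proof.
move=> Kk a0 Ea; have [h1 h2] := lev_itv k.
have [h3 h4] := breakpoint_itv (leqnn l).
have h5 : r * K%:R <= E%:R / g ^+ l by rewrite ler_pdivlMr.
have h6 : E%:R / g ^+ l <= r * K%:R + a.
  rewrite ler_pdivrMr //; apply: le_trans Ea _; rewrite mulrDl lerD2l.
  by rewrite ler_peMr // exprn_ege1 // ltW.
have h7 : r * K%:R <= g * k%:R.
  apply: (@le_trans _ _ (g * K%:R)); first by rewrite ler_wpM2r // ltW.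
  by rewrite ler_wpM2l ?ler_nat // ltW.
rewrite natr_min ler_norml /Num.min; case: ltP => hm; apply/andP; split; lra.
Qed.

(** Between the breakpoints the drift [tv - u] of one block is compensated by
    the rate [g * Iv] of the preceding one, because the columns up to level
    [lev k ~ g * k] are paid for at time [k]. *)
Lemma block_balance (tv Iv : nat -> R) (u a : R) : 0 <= a ->
  E%:R <= r * K%:R * g ^+ l + a ->
  Iv 0%N = 0 -> (forall j, (j <= l)%N -> tv j.+1 = u + g * Iv j) ->
  tv l.+2 - Iv l.+2 - u - (r - 1) * Iv l.+1 - (g - r) * Iv l = 0 ->
  forall k, (K <= k <= E)%N ->
  `|\sum_(q < k) tv (block c l.+2 q) - \sum_(q < lev k) Iv (block c l.+2 q)
    - k%:R * u| <=
    g * (\sum_(j < l) `|Iv j.+1 - Iv j|) + (a + 1) * `|Iv l.+1 - Iv l|.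
Proof.
move=> a0 Ea I0 tvE root k /andP[Kk kE].
have anti : forall i j, (i <= j < l.+2)%N -> (c j <= c i)%N by exact: breakpoint_antitone.
have sumE (f : nat -> R) b : \sum_(q < b) f (block c l.+2 q) =
   f 0%N * b%:R + \sum_(j < l.+2) (f j.+1 - f j) * (minn b (c j))%:R.
  have := sum_block anti f (fun=> 1) b.
  under eq_bigr do rewrite mulr1.
  move=> ->; rewrite sumr_const card_ord; congr (_ + _).
  by apply: eq_bigr => j _; rewrite sumr_const card_ord.
rewrite !sumE I0 mul0r add0r big_ord_recl /= big_ord_recr /=.
rewrite [X in _ - X - _]big_ord_recr /= [X in _ - (X + _) - _]big_ord_recr /=.
rewrite breakpoint0 breakpoint_last (minn_idPl kE).
rewrite (minn_idPr Kk) (minn_idPr (_ : (K <= lev k)%N)); last first.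
  rewrite -(ler_nat R); have [h1 h2] := lev_itv k.
  suff : (K < (lev k).+1)%N by rewrite ltnS ler_nat.
  rewrite -(ltr_nat R) -natr1; apply: le_lt_trans h2.
  apply: (@le_trans _ _ k%:R); first by rewrite ler_nat.
  by rewrite ler_peMl // ltW.
set s1 := \sum_(i < l) _; set s2 := \sum_(i < l) _.
have t1 : tv 1%N = u by rewrite tvE // I0 mulr0 addr0.
have e1 : s1 - s2 = \sum_(j < l) (Iv j.+1 - Iv j) *
   (g * (minn k (c j.+1))%:R - (minn (lev k) (c j))%:R).
  rewrite /s1 /s2 -sumrB; apply: eq_bigr => j _.
  rewrite (tvE j.+1) ?ltn_ord // (tvE j) ?(ltnW (ltn_ord _)) //.
  by rewrite /bump /=; ring.
have h1 : `|s1 - s2| <= g * (\sum_(j < l) `|Iv j.+1 - Iv j|).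
  rewrite e1 mulr_sumr; apply: (le_trans (ler_norm_sum _ _ _)).
  apply: ler_sum => j _; rewrite normrM mulrC ler_wpM2r //.
  by apply: min_level_dist; apply: ltn_ord.
have h2 := last_level_dist Kk a0 Ea.
set M := (minn (lev k) (c l))%:R in h2 *.
have e2 : tv l.+1 = u + g * Iv l by rewrite tvE.
have -> : tv 0%N * k%:R + ((tv 1%N - tv 0%N) * k%:R + (s1 + (tv l.+2 - tv l.+1) * K%:R))
  - (s2 + (Iv l.+1 - Iv l) * M + (Iv l.+2 - Iv l.+1) * K%:R) - k%:R * u =
  (s1 - s2) + (Iv l.+1 - Iv l) * (r * K%:R - M) +
  (tv l.+2 - Iv l.+2 - u - (r - 1) * Iv l.+1 - (g - r) * Iv l) * K%:R.
  by rewrite e2 t1; ring.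
rewrite root mul0r addr0; apply: (le_trans (ler_normD _ _)).
by apply: lerD => //; rewrite normrM mulrC ler_wpM2r.
Qed.

End Balance.

(** * Coding of the carpet *)

Section Plane.
Variable R : realType.
Local Notation plane := 'rV[R]_2.

Lemma edist2E (p q : plane) : Defs.edist p q =
  Num.sqrt ((p 0 ord0 - q 0 ord0) ^+ 2 + (p 0 ord_max - q 0 ord_max) ^+ 2).
Proof.
rewrite /Defs.edist big_ord_recl big_ord1.
by have -> : lift ord0 ord0 = ord_max :> 'I_2 by apply: val_inj.
Qed.

Lemma edist_ge_coord (p q : plane) (i : 'I_2) : `|p 0 i - q 0 i| <= Defs.edist p q.
Proof.
rewrite edist2E -sqrtr_sqr ler_wsqrtr //.
have [->|->] : i = ord0 \/ i = ord_max.
- case: i => [[|[|//]]] hi; [left|right]; exact: val_inj.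
- by rewrite lerDl sqr_ge0.
- by rewrite lerDr sqr_ge0.
Qed.

Lemma edist_le_coord (p q : plane) :
  Defs.edist p q <= `|p 0 ord0 - q 0 ord0| + `|p 0 ord_max - q 0 ord_max|.
Proof.
rewrite edist2E -(ler_pXn2r (ltn0Sn 1)) ?nnegrE ?addr_ge0 ?sqrtr_ge0 //.
rewrite sqr_sqrtr ?addr_ge0 ?sqr_ge0 //.
by rewrite [leRHS]sqrrD !real_normK ?num_real // -addrA lerD2l lerDr mulrn_wge0 // mulr_ge0.
Qed.

Lemma coord_le_norm (z : plane) (j : 'I_2) : `|z 0 j| <= `|z|.
Proof.
have -> : `|z| = mx_norm z by [].
rewrite mx_normrE.
exact: (le_bigmax 0 (fun ij => `|z ij.1 ij.2|) (0, j)).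
Qed.

Lemma edist_le_diam (U : set plane) p q : U p -> U q -> ((Defs.edist p q)%:E <= diam U)%E.
Proof.
move=> Up Uq; rewrite /diam le_max; apply/orP; right.
by apply: ereal_sup_ubound; exists (p, q).
Qed.

Lemma diam_ge0 (d : nat) (U : set 'rV[R]_d) : (0 <= diam U)%E.
Proof. by rewrite /diam le_max lexx. Qed.

Lemma diam_le (U : set plane) (r : R) : 0 <= r ->
  (forall p q, U p -> U q -> Defs.edist p q <= r) -> (diam U <= r%:E)%E.
Proof.
move=> r0 h; rewrite /diam ge_max lee_fin r0 /=.
by apply: ge_ereal_sup => _ [[p q] [/= Up Uq] <-]; rewrite lee_fin h.
Qed.

Definition square (a b c : R) : set plane :=
  [set z | a <= z 0 ord0 <= a + c /\ b <= z 0 ord_max <= b + c].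

Lemma diam_square (a b c : R) : 0 <= c ->
  (c%:E <= diam (square a b c) <= (2 * c)%:E)%E.
Proof.
move=> c0; apply/andP; split; last first.
  apply: diam_le; first by rewrite mulr_ge0.
  move=> p q [/andP[h1 h2] /andP[h3 h4]] [/andP[h5 h6] /andP[h7 h8]].
  apply: (le_trans (edist_le_coord _ _)); rewrite mulr_natl mulr2n.
  by apply: lerD; rewrite ler_norml; apply/andP; split; lra.
pose p : plane := \row_(k < 2) (if k == ord0 then a else b).
pose q : plane := \row_(k < 2) (if k == ord0 then a + c else b).
have Sp : square a b c p by rewrite /square /= !mxE /=; split; apply/andP; split; lra.
have Sq : square a b c q by rewrite /square /= !mxE /=; split; apply/andP; split; lra.
apply: le_trans (edist_le_diam Sp Sq); rewrite lee_fin.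
apply: le_trans (edist_ge_coord _ _ ord0); rewrite !mxE /= opprD addrA subrr sub0r.
by rewrite normrN ger0_norm.
Qed.

End Plane.

(** A bounded set whose points [y] are of the form [(y' + d) / b], with [y'] in
    the set and [d] a base-[b] digit, lies in the unit interval. *)
Lemma digit_set_itv (R : realType) (S : set R) (b : nat) (B : R) : (1 < b)%N ->
  (forall y, S y -> `|y| <= B) ->
  (forall y, S y -> exists y' d, [/\ S y', (d < b)%N & y = (y' + d%:R) / b%:R]) ->
  forall y, S y -> 0 <= y <= 1.
Proof.
move=> b1 SB Sd y Sy; have b0 : 0 < b%:R :> R by rewrite ltr0n ltnW.
have b1' : 1 < b%:R :> R by rewrite ltr1n.
have S0 : S !=set0 by exists y.
have ubS : has_ubound S by exists B => z /SB; rewrite ler_norml => /andP[].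
have lbS : has_lbound S by exists (- B) => z /SB; rewrite ler_norml => /andP[].
apply/andP; split.
  apply: le_trans (ge_inf lbS Sy).
  have h : inf S / b%:R <= inf S.
    apply: lb_le_inf => // z /Sd [z' [d [Sz' db ->]]].
    rewrite ler_pM2r ?invr_gt0 //; apply: (le_trans (ge_inf lbS Sz')).
    by rewrite lerDl.
  rewrite leNgt; apply/negP => i0; move: h; rewrite ler_pdivrMr // leNgt.
  by rewrite gtr_nMr // b1'.
apply: (le_trans (ub_le_sup ubS Sy)).
have h : sup S <= (sup S + (b%:R - 1)) / b%:R.
  apply: ge_sup => // z /Sd [z' [d [Sz' db ->]]].
  rewrite ler_pM2r ?invr_gt0 //; apply: lerD; first exact: ub_le_sup.
  by rewrite lerBrDr natr1 ler_nat.
move: h; rewrite ler_pdivlMr // => h.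
have : sup S * (b%:R - 1) <= 1 * (b%:R - 1) by lra.
by rewrite ler_pM2r // subr_gt0.
Qed.

Section Coding.
Variables (R : realType) (m n : nat) (A : {set 'I_m * 'I_n}).
Variable Lambda : set 'rV[R]_2.
Hypotheses (m_gt1 : (1 < m)%N) (n_gt1 : (1 < n)%N).
Hypothesis carpetL : is_carpet A Lambda.

Local Notation letter := ('I_m * 'I_n)%type.

Lemma carpet_shift z : Lambda z ->
  exists a z', [/\ a \in A, Lambda z' & z = carpet_map a z'].
Proof.
case: carpetL => _ _ e; rewrite {1}e => -[a /= aA [z' z'L <-]].
by exists a, z'.
Qed.

Lemma carpet_map_in a z : a \in A -> Lambda z -> Lambda (carpet_map a z).
Proof.
move=> aA zL; case: carpetL => _ _ e; by rewrite e; exists a.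
Qed.

Lemma carpet_map0 (a : letter) (z : 'rV[R]_2) :
  carpet_map a z 0 ord0 = (z 0 ord0 + (a.1 : nat)%:R) / m%:R.
Proof. by rewrite mxE eqxx. Qed.

Lemma carpet_map1 (a : letter) (z : 'rV[R]_2) :
  carpet_map a z 0 ord_max = (z 0 ord_max + (a.2 : nat)%:R) / n%:R.
Proof. by rewrite mxE. Qed.

Lemma carpet_itv z i : Lambda z -> 0 <= z 0 i <= 1.
Proof.
case: (carpetL) => _ cL _ zL.
have [B HB] : exists B : R, forall z, Lambda z -> `|z| <= B.
  have /= := compact_bounded cL; rewrite /bounded_set /= => -[M [_ HM]].
  by exists (M + 1) => z' z'L; apply: HM => //; rewrite ltrDl.
have HB' (j : 'I_2) y : [set z' 0 j | z' in Lambda] y -> `|y| <= B.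
  by move=> [z' z'L <-]; apply: le_trans (coord_le_norm z' j) (HB _ z'L).
have [->|->] : i = ord0 \/ i = ord_max.
- by case: i => [[|[|//]]] hi; [left|right]; apply: val_inj.
- apply: (digit_set_itv m_gt1 (HB' ord0)); last by exists z.
  move=> _ [z1 z1L <-]; have [a [z2 [aA z2L ->]]] := carpet_shift z1L.
  exists (z2 0 ord0), a.1; rewrite carpet_map0; split => //.
  by exists z2.
- apply: (digit_set_itv n_gt1 (HB' ord_max)); last by exists z.
  move=> _ [z1 z1L <-]; have [a [z2 [aA z2L ->]]] := carpet_shift z1L.
  exists (z2 0 ord_max), a.2; rewrite carpet_map1; split => //.
  by exists z2.
Qed.

(** The first [D] letters of [w] lead from the point [zs 0] to [zs D]. *)
Definition coded (D : nat) (w : nat -> letter) (zs : nat -> 'rV[R]_2) : Prop :=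
  (forall q, (q <= D)%N -> Lambda (zs q)) /\
  (forall q, (q < D)%N -> zs q = carpet_map (w q) (zs q.+1)).

Lemma coded_coords D w zs : coded D w zs -> forall q, (q <= D)%N ->
  zs 0%N 0 ord0 * m%:R ^+ q =
    (prefix_value m (fun j => (w j).1) q)%:R + zs q 0 ord0 /\
  zs 0%N 0 ord_max * n%:R ^+ q =
    (prefix_value n (fun j => (w j).2) q)%:R + zs q 0 ord_max.
Proof.
move=> [_ step]; have m0 : m%:R != 0 :> R by rewrite pnatr_eq0 -lt0n ltnW.
have n0 : n%:R != 0 :> R by rewrite pnatr_eq0 -lt0n ltnW.
elim=> [_|q IH qD]; first by rewrite !expr0 !mulr1 !add0r.
have [e1 e2] := IH (ltnW qD).
rewrite !exprSr !mulrA e1 e2 (step q qD) carpet_map0 carpet_map1 /=.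
by split; rewrite mulrDl divfK // natrD natrM; ring.
Qed.

Lemma exists_code z : Lambda z -> exists w, (forall q, w q \in A) /\
  forall D, exists2 zs, coded D w zs & zs 0%N = z.
Proof.
move=> zL.
have [a0 _] := carpet_shift zL.
have [|f fP] := @boolp.choice _ _ (fun z (p : letter * 'rV[R]_2) =>
    Lambda z -> [/\ p.1 \in A, Lambda p.2 & z = carpet_map p.1 p.2]).
  move=> z'; case: (pselect (Lambda z')) => [/carpet_shift|hz].
    by move=> [a [z2 h]]; exists (a, z2).
  by exists (a0, z').
pose zs q := iter q (fun z => (f z).2) z.
have zsL q : Lambda (zs q) by elim: q => // q IH; have [] := fP _ IH.
exists (fun q => (f (zs q)).1); split => [q|D]; first by have [] := fP _ (zsL q).
by exists zs => //; split => // q _; have [] := fP _ (zsL q).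
Qed.

(** Any finite word over the alphabet codes some point, by induction from the
    last letter. *)
Lemma exists_coded D w : (forall q, (q < D)%N -> w q \in A) -> exists zs, coded D w zs.
Proof.
case: (carpetL) => [[z0 z0L] _ _].
elim: D w => [|D IH] w wA; first by exists (fun=> z0).
have [zs [zsL step]] := IH (fun q => w q.+1) (fun q => wA q.+1).
exists (fun q => if q is q'.+1 then zs q' else carpet_map (w 0%N) (zs 0%N)).
split; first by case=> [_|q /zsL //]; apply: carpet_map_in; [exact: wA|exact: zsL].
by case=> // q /step.
Qed.

End Coding.

(** * Approximate squares *)

Section Levels.
Variables (R : realType) (m n : nat).
Hypotheses (m_gt1 : (1 < m)%N) (m_lt_n : (m < n)%N).

Let n_gt1 : (1 < n)%N. Proof. exact: ltn_trans m_lt_n. Qed.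

(** The approximate squares of level [k] have height [n^-k] and width
    [m^- level k], the least power of [m^-1] that is at least the height. *)
Definition level (k : nat) : nat := trunc_log m (n ^ k).

Lemma leq_level k : (k <= level k)%N.
Proof.
apply: trunc_log_max => //.
by case: k => // k; rewrite leq_exp2r // ltnW.
Qed.

Lemma homo_level k k' : (k <= k')%N -> (level k <= level k')%N.
Proof.
move=> kk; apply: trunc_log_max => //.
apply: (@leq_trans (n ^ k)); first by rewrite trunc_logP // expn_gt0 ltnW.
by rewrite leq_exp2l.
Qed.

Lemma ln_m_gt0 : 0 < ln m%:R :> R.
Proof. by rewrite ln_gt0 // ltr1n. Qed.

Lemma ln_n_gt0 : 0 < ln n%:R :> R.
Proof. by rewrite ln_gt0 // ltr1n. Qed.

Lemma carpet_gamma_gt1 : 1 < carpet_gamma R m n.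
Proof.
rewrite /carpet_gamma ltr_pdivlMr ?ln_m_gt0 // mul1r ltr_ln ?ltr_nat //.
  by rewrite posrE ltr0n ltnW.
by rewrite posrE ltr0n ltnW.
Qed.

(** The depth of the columns at level [k] is the integer part of [g * k]. *)
Lemma level_itv k : (level k)%:R <= carpet_gamma R m n * k%:R /\
  carpet_gamma R m n * k%:R < (level k)%:R + 1.
Proof.
have m0 : 0 < m%:R :> R by rewrite ltr0n ltnW.
have n0 : 0 < n%:R :> R by rewrite ltr0n ltnW.
have h1 : (m ^ level k <= n ^ k)%N by rewrite trunc_logP // expn_gt0 ltnW.
have h2 : (n ^ k < m ^ (level k).+1)%N by rewrite trunc_log_ltn.
have lnX b j : 0 < b%:R :> R -> ln ((b ^ j)%:R) = ln b%:R * j%:R :> R.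
  by move=> b0; rewrite natrX lnXn // mulr_natr.
have e : carpet_gamma R m n * k%:R = ln (n ^ k)%:R / ln m%:R.
  by rewrite lnX // /carpet_gamma mulrAC.
rewrite e ler_pdivlMr ?ln_m_gt0 // ltr_pdivrMr ?ln_m_gt0 // natr1.
rewrite (mulrC (level k)%:R) (mulrC (level k).+1%:R) -!lnX //.
rewrite ler_ln ?ltr_ln ?ler_nat ?ltr_nat ?posrE ?ltr0n ?expn_gt0 ?(ltnW m_gt1) ?(ltnW n_gt1) //.
Qed.

Lemma level_pow k : (m%:R ^+ level k)^-1 <= m%:R * (n%:R ^+ k)^-1 :> R /\
  (n%:R ^+ k)^-1 <= (m%:R ^+ level k)^-1 :> R.
Proof.
have m0 : 0 < m%:R :> R by rewrite ltr0n ltnW.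
have n0 : 0 < n%:R :> R by rewrite ltr0n ltnW.
have h1 : (m ^ level k <= n ^ k)%N by rewrite trunc_logP // expn_gt0 ltnW.
have h2 : (n ^ k < m ^ (level k).+1)%N by rewrite trunc_log_ltn.
split; last by rewrite lef_pV2 ?posrE ?exprn_gt0 // -!natrX ler_nat.
rewrite -div1r ler_pdivrMr ?exprn_gt0 // mulrAC ler_pdivlMr ?exprn_gt0 // mul1r.
by rewrite -exprS -!natrX ler_nat ltnW.
Qed.

Lemma expR_level k : expR (- (k%:R * ln n%:R)) = (n%:R ^+ k)^-1 :> R.
Proof.
rewrite expRN; congr (_^-1); rewrite mulrC expRM_natr lnK //.
by rewrite posrE ltr0n ltnW.
Qed.

End Levels.

Section MassDistribution.
Variables (R : realType) (m n : nat) (A : {set 'I_m * 'I_n}).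
Variable Lambda : set 'rV[R]_2.
Hypotheses (m_gt1 : (1 < m)%N) (m_lt_n : (m < n)%N).
Hypothesis A_neq0 : A != finset.set0.
Hypothesis carpetL : is_carpet A Lambda.

Local Notation letter := ('I_m * 'I_n)%type.
Local Notation lev := (level m n).

Let n_gt1 : (1 < n)%N. Proof. exact: ltn_trans m_lt_n. Qed.

(** The logarithm of the ratio of the cost [n^-(k s)] of an approximate square
    of level [k] and its mass. *)
Definition log_ratio (lam : nat -> R) (s : R) (k : nat) (w : nat -> letter) : R :=
  - (k%:R * ln n%:R) * s - log_cell_mass A lam (lev k) k w.

(** Two reals at distance at most [1 / b] have integer parts, at scale [b], that
    differ by at most 2, even when the fractional parts may be equal to 1. *)
Lemma near_index (X X' : R) (a a' : nat) (t t' c : R) (b : nat) :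
  0 <= t <= 1 -> 0 <= t' <= 1 -> X * b%:R = a%:R + t -> X' * b%:R = a'%:R + t' ->
  (0 < b)%N -> `|X - X'| <= c -> c <= b%:R^-1 -> (a' <= a + 2)%N.
Proof.
move=> t01 t01' e e' b0 Xc cb; have b0' : 0 < b%:R :> R by rewrite ltr0n.
rewrite -(ler_nat R) natrD.
have : (X' - X) * b%:R <= 1.
  rewrite -ler_pdivlMr // mul1r; apply: le_trans cb; apply: le_trans Xc.
  by rewrite distrC ler_norm.
by rewrite mulrBl e e'; lra.
Qed.

(** A set of diameter at most [n^-k] meets at most 25 approximate squares of
    level [k], at most two to either side of a given one in both directions. *)
Lemma mass_distribution (lam : nat -> R) (s B : R) (K E D : nat)
    (J : set nat) (U : nat -> set 'rV[R]_2) (kap : nat -> nat)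
    (G : pred {ffun 'I_D.+1 -> letter}) :
  covers J U Lambda -> (lev E <= D.+1)%N ->
  (forall i, J i -> (K <= kap i <= E)%N /\
    (diam (U i) <= ((n%:R ^+ kap i)^-1)%:E)%E) ->
  (forall w k, G w -> (K <= k <= E)%N -> B <= log_ratio lam s k (digits w)) ->
  exists r : seq nat, [/\ uniq r, (forall i, i \in r -> J i) &
    \sum_(w | G w) word_mass A lam w <=
    25%:R * expR (- B) * \sum_(i <- r) expR (- ((kap i)%:R * ln n%:R) * s)].
Proof.
move=> cov ED UJ Bk.
pose good w := G w && (word_mass A lam w != 0).
have [|f fP] := @boolp.choice _ _ (fun w i => good w ->
    J i /\ exists zs, coded Lambda D.+1 (digits w) zs /\ U i (zs 0%N)).
  move=> w; case: (boolP (good w)) => [/andP[_ w0]|_]; last by exists 0%N.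
  have [zs czs] := exists_coded (w := digits w) carpetL (D := D.+1)
    (fun q _ => word_mass_neq0 q w0).
  have [i iJ Ui] := cov _ (proj1 czs 0%N isT).
  by exists i => _; split => //; exists zs.
pose r := undup [seq f w | w <- enum good].
have rJ i : i \in r -> J i.
  by rewrite mem_undup => /mapP [w]; rewrite mem_enum => /fP[h _] ->.
exists r; split; [exact: undup_uniq|exact: rJ|].
have -> : \sum_(w | G w) word_mass A lam w =
  \sum_(i <- r) \sum_(w | good w && (f w == i)) word_mass A lam w.
  transitivity (\sum_(w | good w) word_mass A lam w).
    rewrite [LHS](bigID (fun w => word_mass A lam w != 0)) /= addrC big1 ?add0r //.
    by move=> w /andP[_ /negPn/eqP].
  rewrite (exchange_big_dep good) /=; last by move=> i w _ /andP[].
  apply: eq_bigr => w gw.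
  rewrite (eq_bigl (fun i => i == f w)); last by move=> i; rewrite gw eq_sym.
  rewrite -big_filter filter_pred1_uniq ?undup_uniq ?big_seq1 //.
  by rewrite mem_undup; apply/mapP; exists w => //; rewrite mem_enum.
rewrite mulr_sumr big_seq [leRHS]big_seq; apply: ler_sum => i ir.
have [w0 /andP[gw0 /eqP fw0]|no] := pickP (fun w => good w && (f w == i)); last first.
  rewrite big_pred0 //; by rewrite !mulr_ge0 // expR_ge0.
set k := kap i; have [/andP[Kk kE] dU] := UJ i (rJ i ir).
pose px (w : {ffun 'I_D.+1 -> letter}) := prefix_value m (fun q => (digits w q).1) (lev k).
pose py (w : {ffun 'I_D.+1 -> letter}) := prefix_value n (fun q => (digits w q).2) k.
pose off (w : {ffun 'I_D.+1 -> letter}) : 'I_5 * 'I_5 :=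
  (inord (px w + 2 - px w0), inord (py w + 2 - py w0)).
have lkD : (lev k <= D.+1)%N by apply: leq_trans ED; apply: homo_level.
have kD : (k <= D.+1)%N by apply: leq_trans lkD; apply: leq_level.
have near w w' : good w && (f w == i) -> good w' && (f w' == i) ->
    (px w' <= px w + 2)%N /\ (py w' <= py w + 2)%N.
  move=> /andP[/fP[_ [zs [czs Uz]]] /eqP fw] /andP[/fP[_ [zs' [czs' Uz']]] /eqP fw'].
  rewrite fw in Uz; rewrite fw' in Uz'.
  have de : Defs.edist (zs 0%N) (zs' 0%N) <= (n%:R ^+ k)^-1.
    by rewrite -lee_fin; apply: le_trans (edist_le_diam Uz Uz') dU.
  have [ex _] := coded_coords m_gt1 n_gt1 czs lkD.
  have [ex' _] := coded_coords m_gt1 n_gt1 czs' lkD.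
  have [_ ey] := coded_coords m_gt1 n_gt1 czs kD.
  have [_ ey'] := coded_coords m_gt1 n_gt1 czs' kD.
  have itv := carpet_itv m_gt1 n_gt1 carpetL.
  have [z1 _] := czs; have [z1' _] := czs'.
  have [_ lp] := level_pow R m_gt1 m_lt_n k.
  split.
    apply: (near_index (b := (m ^ lev k)%N) (itv _ _ (z1 _ lkD)) (itv _ _ (z1' _ lkD))).
    - by rewrite natrX; exact: ex.
    - by rewrite natrX; exact: ex'.
    - by rewrite expn_gt0 ltnW.
    - exact: le_trans (edist_ge_coord _ _ _) de.
    - by rewrite natrX.
  apply: (near_index (b := (n ^ k)%N) (itv _ _ (z1 _ kD)) (itv _ _ (z1' _ kD))).
  - by rewrite natrX; exact: ey.
  - by rewrite natrX; exact: ey'.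
  - by rewrite expn_gt0 ltnW.
  - exact: le_trans (edist_ge_coord _ _ _) de.
  - by rewrite natrX.
rewrite (partition_big off xpredT) //=.
have -> : 25%:R * expR (- B) * expR (- (k%:R * ln n%:R) * s) =
  \sum_(o : 'I_5 * 'I_5) expR (- B) * expR (- (k%:R * ln n%:R) * s) :> R.
  by rewrite sumr_const card_prod !card_ord -[RHS]mulr_natl mulrA.
apply: ler_sum => o _.
have [w1 /andP[gw1 /eqP ow1]|no] :=
  pickP (fun w => (good w && (f w == i)) && (off w == o)); last first.
  by rewrite big_pred0 // mulr_ge0 // expR_ge0.
apply: (@le_trans _ _ (\sum_(w : {ffun 'I_D.+1 -> letter} |
   cell (lev k) k (digits w) == cell (lev k) k (digits w1)) word_mass A lam w)).
  rewrite [leLHS]big_mkcond [leRHS]big_mkcond; apply: ler_sum => w _.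
  case: ifP => [/andP[gw /eqP ow]|_]; last first.
    by case: ifP => // _; apply: word_mass_ge0.
  suff -> : cell (lev k) k (digits w) == cell (lev k) k (digits w1) by [].
  have gfw0 : good w0 && (f w0 == i) by rewrite gw0 fw0 eqxx.
  have [a1 a2] := near _ _ gfw0 gw; have [a3 a4] := near _ _ gfw0 gw1.
  have [b1 b2] := near _ _ gw gfw0; have [b3 b4] := near _ _ gw1 gfw0.
  have := ow; rewrite -ow1 => -[/(congr1 val) e1 /(congr1 val) e2].
  rewrite /= !inordK in e1; try lia.
  rewrite /= !inordK in e2; try lia.
  by rewrite /cell -/(px w) -/(px w1) -/(py w) -/(py w1); apply/eqP; congr (_, _); lia.
have /andP[/andP[Gw1 mw1] _] := gw1.
rewrite (cell_mass A_neq0 (D := D)) //; [|exact: leq_level|by move=> q _; exact: word_mass_neq0 mw1].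
rewrite -expRD ler_expR; have := Bk w1 k Gw1; rewrite Kk kE => /(_ isT).
rewrite /log_ratio; lra.
Qed.

(** If every code has a level where the ratio of cost and mass is at most
    [exp B], then the squares of these levels form a finite cover whose cost is
    at most [exp B] for each of the levels, since masses sum to 1. Several codes
    share a square, so the cover is indexed by the positions of the squares. *)
Lemma cover_by_squares (lam : nat -> R) (s B : R) (K E D : nat) (side : nat -> R) :
  (lev E <= D.+1)%N ->
  (forall w : nat -> letter, (forall q, w q \in A) ->
     exists2 k, (K <= k <= E)%N & log_ratio lam s k w <= B) ->
  (forall k, (K <= k <= E)%N -> m%:R * (n%:R ^+ k)^-1 <= side k) ->
  exists (N : nat) (U : nat -> set 'rV[R]_2) (kap : nat -> nat),
    [/\ covers `I_N U Lambda,
      forall i, (i < N)%N -> (K <= kap i <= E)%N /\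
        ((side (kap i))%:E <= diam (U i) <= (2 * side (kap i))%:E)%E &
      \sum_(i < N) expR (- ((kap i)%:R * ln n%:R) * s) <= (E.+1 - K)%:R * expR B].
Proof.
move=> ED sel sidek.
have [a0 a0A] : exists a, a \in A by apply/set0Pn.
(* The rule is applied to codes, hence letters off the alphabet are replaced. *)
pose clip (w : nat -> letter) q := if w q \in A then w q else a0.
have clipA w q : clip w q \in A by rewrite /clip; case: ifP.
have [|kw kwP] := @boolp.choice _ _ (fun w k => (K <= k <= E)%N /\
    log_ratio lam s k (clip w) <= B).
  by move=> w; have [k] := sel _ (clipA w); exists k.
pose word := {ffun 'I_D.+1 -> letter}.
pose key k (w : nat -> letter) : nat * (nat * nat) := (k, cell (lev k) k w).
pose keys := undup [seq key (kw (digits w)) (clip (digits w)) | w : word].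
pose U i : set 'rV[R]_2 := let: (k, (a, b)) := nth (0, (0, 0))%N keys i in
  square (a%:R / m%:R ^+ lev k) (b%:R / n%:R ^+ k) (side k).
pose kap i := (nth (0, (0, 0))%N keys i).1.
have keysP i : (i < size keys)%N -> exists w : word,
    nth (0, (0, 0))%N keys i = key (kw (digits w)) (clip (digits w)).
  move=> /(mem_nth (0, (0, 0))%N); rewrite mem_undup => /mapP[w _ e].
  by exists w.
have side_ge0 k : (K <= k <= E)%N -> 0 <= side k.
  by move=> /sidek; apply: le_trans; rewrite mulr_ge0 // invr_ge0 exprn_ge0.
exists (size keys), U, kap; split.
- move=> z zL; have [w [wA code]] := exists_code carpetL zL.
  have [zs czs z0] := code D.+1.
  pose v : word := [ffun q : 'I_D.+1 => w q].
  have dv q : (q < D.+1)%N -> digits v q = w q.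
    by move=> qD; rewrite /digits ffunE inordK.
  set k := kw (digits v); have [/andP[Kk kE] _] := kwP (digits v).
  have lkD : (lev k <= D.+1)%N by apply: leq_trans ED; apply: homo_level.
  have kD : (k <= D.+1)%N by apply: leq_trans lkD; apply: leq_level.
  have cvE q : (q < D.+1)%N -> clip (digits v) q = w q.
    by move=> qD; rewrite /clip dv // wA.
  have cellE : cell (lev k) k (clip (digits v)) = cell (lev k) k w.
    apply/eqP/cell_eqP; split=> q ql; rewrite cvE //.
      exact: leq_trans ql lkD.
    exact: leq_trans ql kD.
  have kin : key k (clip (digits v)) \in keys.
    by rewrite mem_undup; apply/mapP; exists v => //; rewrite mem_enum.
  exists (index (key k (clip (digits v))) keys); first by rewrite /= index_mem.
  rewrite /U nth_index // /key cellE /cell /= -z0.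
  have [ex _] := coded_coords m_gt1 n_gt1 czs lkD.
  have [_ ey] := coded_coords m_gt1 n_gt1 czs kD.
  have itv := carpet_itv m_gt1 n_gt1 carpetL; have [z1 _] := czs.
  have mX : 0 < m%:R ^+ lev k :> R by rewrite exprn_gt0 // ltr0n ltnW.
  have nX : 0 < n%:R ^+ k :> R by rewrite exprn_gt0 // ltr0n ltnW.
  have [lp _] := level_pow R m_gt1 m_lt_n k.
  have sk := sidek k; rewrite Kk kE in sk; have {}sk := sk isT.
  have frac (X a t M c : R) : 0 < M -> X * M = a + t -> 0 <= t <= 1 -> M^-1 <= c ->
      a / M <= X <= a / M + c.
    move=> M0 e /andP[t0 t1] Mc.
    have -> : X = a / M + t / M by rewrite -mulrDl -e mulfK // gt_eqF.
    rewrite lerDl divr_ge0 ?(ltW M0) // lerD2l; apply: le_trans Mc.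
    by rewrite ler_piMl // invr_ge0 ltW.
  split; apply: frac => //; [exact: ex|exact: itv (z1 _ lkD)| |exact: ey|exact: itv (z1 _ kD)|].
    exact: le_trans lp sk.
  by apply: le_trans sk; rewrite ler_peMl ?invr_ge0 ?(ltW nX) // ler1n ltnW.
- move=> i /keysP [w e]; have [h _] := kwP (digits w).
  have -> : kap i = kw (digits w) by rewrite /kap e.
  split => //; rewrite /U e /=.
  exact: diam_square (side_ge0 _ h).
- have -> : \sum_(i < size keys) expR (- ((kap i)%:R * ln n%:R) * s) =
     \sum_(x <- keys) expR (- (x.1%:R * ln n%:R) * s).
    by rewrite (big_nth (0, (0, 0))%N) big_mkord.
  apply: (@le_trans _ _ (\sum_(x <- keys) expR B * \sum_(w : word |
      cell (lev x.1) x.1 (digits w) == x.2) word_mass A lam w)).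
    rewrite big_seq [leRHS]big_seq; apply: ler_sum => x.
    rewrite mem_undup => /mapP[w _ ->] /=.
    have [/andP[Kk kE] hB] := kwP (digits w).
    rewrite (cell_mass A_neq0) //.
    - by rewrite -expRD ler_expR; move: hB; rewrite /log_ratio; lra.
    - exact: leq_level.
    - by apply: leq_trans ED; apply: homo_level.
  rewrite -mulr_sumr mulrC ler_wpM2r ?expR_ge0 //.
  rewrite (exchange_big_dep xpredT) //=.
  apply: (@le_trans _ _ (\sum_(w : word) word_mass A lam w * (E.+1 - K)%:R)); last first.
    by rewrite -mulr_suml sum_word_mass // mul1r.
  apply: ler_sum => w _; rewrite -big_filter big_const_seq count_predT iter_addr_0 -[leLHS]mulr_natr.
  rewrite ler_wpM2l ?word_mass_ge0 // ler_nat.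
  have -> : (E.+1 - K)%N = size [seq key k (digits w) | k <- index_iota K E.+1].
    by rewrite size_map size_iota.
  apply: uniq_leq_size; first by rewrite filter_uniq // undup_uniq.
  move=> x; rewrite mem_filter mem_undup => /andP[/eqP h /mapP[v _ e]].
  apply/mapP; exists x.1; last by rewrite /key h; case: (x).
  by rewrite mem_index_iota ltnS e /=; have [] := kwP (digits v).
Qed.

End MassDistribution.

(** * Uniform concentration and lower bounds for covers *)

Section Decay.
Variable R : realType.

(** Half of the exponent absorbs the linear factor. *)
Lemma linear_exp_small (a b beta eps : R) : 0 <= a -> 0 <= b -> 0 < beta -> 0 < eps ->
  exists K0 : nat, forall K, (K0 <= K)%N ->
    (a * K%:R + b) * expR (- (beta * K%:R)) <= eps.
Proof.
move=> a0 b0 be0 e0; pose c := 2 * a / beta + b.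
have c0 : 0 <= c by rewrite addr_ge0 // divr_ge0 ?mulr_ge0 // ltW.
exists (Num.truncn (2 * c / (eps * beta))).+1 => K K0.
have hK : 2 * c <= eps * beta * K%:R.
  rewrite [leRHS]mulrC -ler_pdivrMr ?mulr_gt0 //.
  by apply: (le_trans (ltW (truncnS_gt _))); rewrite ler_nat.
set y := beta * K%:R / 2.
have y0 : 0 <= y by rewrite !mulr_ge0 // ltW.
have h1 : a * K%:R + b <= c * expR y.
  apply: (@le_trans _ _ (c * (1 + y))); last by rewrite ler_wpM2l // expR_ge1Dx.
  have e1 : 2 * a / beta * y = a * K%:R by rewrite /y; field; rewrite gt_eqF.
  have -> : c * (1 + y) = c + 2 * a / beta * y + b * y by rewrite /c; ring.
  rewrite e1 /c.
  have : 0 <= 2 * a / beta by rewrite divr_ge0 ?mulr_ge0 // ltW.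
  have : 0 <= b * y by rewrite mulr_ge0.
  lra.
have h2 : c <= eps * expR y.
  apply: (@le_trans _ _ (eps * y)); first by rewrite /y; lra.
  by rewrite ler_pM2l // (le_trans _ (expR_ge1Dx y)) // lerDr.
have e : expR (- (beta * K%:R)) = (expR y)^-1 * (expR y)^-1.
  by rewrite -expRN -expRD; congr expR; rewrite /y; lra.
rewrite e mulrA ler_pdivrMr ?expR_gt0 //; apply: le_trans h2.
by rewrite ler_pdivrMr ?expR_gt0.
Qed.

Lemma geometric_tail (c : R) (K E : nat) : 0 < c ->
  \sum_(K <= k < E.+1) expR (- (c * k%:R)) <=
  expR (- (c * K%:R)) / (1 - expR (- c)).
Proof.
move=> c0; have r1 : 0 < 1 - expR (- c) by rewrite subr_gt0 -expR0 ltr_expR oppr_lt0.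
have [KE|EK] := leqP K E.+1; last first.
  by rewrite big_geq ?(ltnW EK) // divr_ge0 ?expR_ge0 // ltW.
rewrite ler_pdivlMr // mulr_suml.
have st (k : nat) : expR (- (c * k%:R)) * (1 - expR (- c)) =
   (- expR (- (c * k.+1%:R))) - (- expR (- (c * k%:R))).
  rewrite mulrBr mulr1 -expRD opprK addrC; congr (- expR _ + _).
  by rewrite -natr1; ring.
under eq_bigr do rewrite st.
rewrite (telescope_sumr (fun k => - expR (- (c * k%:R)))) //.
by rewrite opprK addrC gerBl expR_ge0.
Qed.

Lemma natr_geometric_small (c eps : R) : 0 < c -> 0 < eps ->
  exists K0 : nat, forall K E, (K0 <= K)%N ->
    \sum_(K <= k < E.+1) expR (- (c * k%:R)) <= eps.
Proof.
move=> c0 e0.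
have r1 : 0 < 1 - expR (- c) by rewrite subr_gt0 -expR0 ltr_expR oppr_lt0.
have [K0 h] := linear_exp_small (lexx 0) ler01 c0 (mulr_gt0 e0 r1).
exists K0 => K E /h; rewrite mul0r add0r mul1r => hK.
by apply: (le_trans (geometric_tail K E c0)); rewrite ler_pdivrMr.
Qed.

End Decay.

Section Estimates.
Variables (R : realType) (m n : nat) (A : {set 'I_m * 'I_n}).
Variable Lambda : set 'rV[R]_2.
Hypotheses (m_gt1 : (1 < m)%N) (m_lt_n : (m < n)%N).
Hypothesis A_neq0 : A != finset.set0.
Hypothesis carpetL : is_carpet A Lambda.

Local Notation letter := ('I_m * 'I_n)%type.
Local Notation lev := (level m n).
Local Notation C := (columns A).
Local Notation x := (log_size R A).
Local Notation mean := (tilt_mean C x).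
Local Notation Lam := (logmgf C x).
Local Notation g := (carpet_gamma R m n).

Let n_gt1 : (1 < n)%N. Proof. exact: ltn_trans m_lt_n. Qed.

(** The part of [log_ratio] that depends on the code, centred under the tilts;
    the remaining part is [drift]. *)
Definition balance (lam : nat -> R) (k : nat) (w : nat -> letter) : R :=
  \sum_(q < k) (x (w q).1 - mean (lam q)) -
  \sum_(q < lev k) lam q * (x (w q).1 - mean (lam q)).

Definition drift (lam : nat -> R) (s : R) (k : nat) : R :=
  \sum_(q < k) mean (lam q) -
  \sum_(q < lev k) (lam q * mean (lam q) - Lam (lam q)) +
  (lev k)%:R * ln #|C|%:R - k%:R * ln n%:R * s.

Lemma log_ratioE lam s k w :
  log_ratio A lam s k w = balance lam k w + drift lam s k.
Proof.
rewrite /log_ratio /balance /drift /log_cell_mass.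
rewrite !sumrB !sumr_const !card_ord.
have -> : \sum_(i < lev k) lam i * (x (w i).1 - mean (lam i)) =
  \sum_(i < lev k) lam i * x (w i).1 - \sum_(i < lev k) lam i * mean (lam i).
  by rewrite -sumrB; apply: eq_bigr => i _; rewrite mulrBr.
rewrite -[ln _ *+ _]mulr_natl; ring.
Qed.

Lemma drift_shift lam s s' k :
  drift lam s' k = drift lam s k + k%:R * ln n%:R * (s - s').
Proof. by rewrite /drift; ring. Qed.

(** The law of large numbers for the mass, uniformly over all levels from [K]
    on: the probabilities of the exceptional sets form a geometric series. *)
Lemma balance_concentration (eta : R) : 0 < eta -> exists K0 : nat,
  forall (K E D : nat) (lam : nat -> R), (K0 <= K)%N -> (lev E <= D.+1)%N ->
  (forall q, 0 <= lam q <= 1) ->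
  \sum_(w : {ffun 'I_D.+1 -> letter} |
     has (fun k => balance lam k (digits w) <= - (eta * k%:R)) (index_iota K E.+1))
     word_mass A lam w <= 2^-1.
Proof.
move=> eta0.
have B0 : 0 < ln n%:R :> R by exact: (ln_n_gt0 R m_gt1 m_lt_n).
have g0 : 0 < g by apply: lt_trans (carpet_gamma_gt1 R m_gt1 m_lt_n).
set B := ln n%:R in B0 *.
(* The parameter of the exponential moment: the quadratic term must not exceed
   half of the linear one, given that [level k <= g * k]. *)
pose z := Num.min (2 * B)^-1 (eta / (4 * B ^+ 2 * g)).
have B2g : 0 < 4 * B ^+ 2 * g by rewrite mulr_gt0 // mulr_gt0 // exprn_gt0.
have z0 : 0 < z by rewrite lt_min invr_gt0 mulr_gt0 // divr_gt0.
have zB : z * B <= 2^-1.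
  apply: (@le_trans _ _ ((2 * B)^-1 * B)); first by rewrite ler_pM2r // ge_min lexx.
  by rewrite invfM -mulrA mulVf ?mulr1 // gt_eqF.
have zg : 2 * (z * B) ^+ 2 * g <= z * eta / 2.
  have : z <= eta / (4 * B ^+ 2 * g) by rewrite ge_min lexx orbT.
  rewrite ler_pdivlMr // => h.
  have -> : 2 * (z * B) ^+ 2 * g = z * (z * (4 * B ^+ 2 * g)) / 2 by field.
  by rewrite ler_pM2r ?invr_gt0 // ler_pM2l.
have c0 : 0 < z * eta / 2 by rewrite divr_gt0 // mulr_gt0.
have [|K0 K0P] := @natr_geometric_small R _ 2^-1 c0; first by rewrite invr_gt0.
exists K0 => K E D lam KK ED lam01; apply: le_trans (K0P K E KK).
pose P (w : {ffun 'I_D.+1 -> letter}) k := balance lam k (digits w) <= - (eta * k%:R).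
apply: (@le_trans _ _ (\sum_(K <= k < E.+1) \sum_(w | P w k) word_mass A lam w)).
  rewrite (exchange_big_dep xpredT) //= big_mkcond; apply: ler_sum => w _.
  have m0 := word_mass_ge0 A_neq0 lam w.
  case: ifP => [/hasP[k kK hk]|_]; last by rewrite big_seq_cond sumr_ge0.
  by rewrite -big_filter (bigD1_seq k) /= ?mem_filter ?kK ?filter_uniq ?iota_uniq
    ?andbT // lerDl sumr_ge0.
rewrite big_seq [leRHS]big_seq; apply: ler_sum => k; rewrite mem_index_iota => /andP[Kk kE].
have lkD : (lev k <= D.+1)%N by apply: leq_trans ED; apply: homo_level.
pose c q : R := (q < k)%:R - (q < lev k)%:R * lam q.
have devE (w : {ffun 'I_D.+1 -> letter}) : deviation A lam c w = balance lam k (digits w).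
  rewrite /deviation /balance /c.
  under eq_bigr do rewrite mulrBl -mulrA.
  rewrite sumrB; congr (_ - _).
    rewrite (big_ord_widen _ (fun q => x (digits w q).1 - mean (lam q))
      (leq_trans (leq_level m_gt1 m_lt_n k) lkD)) [RHS]big_mkcond.
    by apply: eq_bigr => q _; case: ifP; rewrite ?mul1r ?mul0r.
  rewrite (big_ord_widen _ (fun q => lam q * (x (digits w q).1 - mean (lam q))) lkD).
  rewrite [RHS]big_mkcond.
  by apply: eq_bigr => q _; case: ifP; rewrite ?mul1r ?mul0r.
under eq_bigl do rewrite /P -devE.
apply: (le_trans (@chernoff R m n A A_neq0 D lam c (lev k) z (eta * k%:R) _ _ (ltW z0) zB)).
- move=> q; rewrite /c; have /andP[l0 l1] := lam01 q.
  have kl := leq_level m_gt1 m_lt_n k.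
  case: (ltnP q k) => qk; first by rewrite (leq_trans qk kl) /= mul1r ler_norml; lra.
  by case: (q < lev k)%N; rewrite /= ?mul1r ?mul0r ler_norml; lra.
- move=> q lq; have kl := leq_level m_gt1 m_lt_n k.
  by rewrite /c !ltnNge lq (leq_trans kl lq) /= mul0r subrr.
rewrite ler_expR.
have [h _] := level_itv R m_gt1 m_lt_n k.
have h2 : 2 * (z * B) ^+ 2 * (lev k)%:R <= z * eta / 2 * k%:R.
  apply: (@le_trans _ _ (2 * (z * B) ^+ 2 * (g * k%:R))).
    by rewrite ler_wpM2l // mulr_ge0 // sqr_ge0.
  by rewrite mulrA ler_wpM2r.
move: h2; rewrite -/B; set t := 2 * _ * _; lra.
Qed.

(** For most codes the approximate squares of every level [k] have mass at most
    [exp (c - eta * k)] times their cost for the exponent [s'], where [eta] is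
    [(s - s') * ln n / 2]: the gain [2 * eta * k] from the smaller exponent
    outweighs the deviation [eta * k]. *)
Lemma cover_cost_lower_bound (s s' : R) : s' < s -> exists K0 : nat,
  forall (K E : nat) (lam : nat -> R) (c : R) (J : set nat)
    (U : nat -> set 'rV[R]_2) (kap : nat -> nat),
  (K0 <= K)%N -> (forall q, 0 <= lam q <= 1) ->
  (forall k, (K <= k <= E)%N -> - c <= drift lam s k) ->
  covers J U Lambda ->
  (forall i, J i -> (K <= kap i <= E)%N /\
    (diam (U i) <= ((n%:R ^+ kap i)^-1)%:E)%E) ->
  exists r : seq nat, [/\ uniq r, (forall i, i \in r -> J i) &
    2^-1 <= 25%:R * expR (c - (s - s') * ln n%:R / 2 * K%:R) *
       \sum_(i <- r) expR (- ((kap i)%:R * ln n%:R) * s')].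
Proof.
move=> ss'; have B0 : 0 < ln n%:R :> R by exact: (ln_n_gt0 R m_gt1 m_lt_n).
set eta := (s - s') * ln n%:R / 2.
have eta0 : 0 < eta by rewrite divr_gt0 // mulr_gt0 // subr_gt0.
have [K0 K0P] := balance_concentration eta0.
exists K0 => K E lam c J U kap KK lam01 dr cov UJ.
pose D := lev E.
have ED : (lev E <= D.+1)%N by [].
pose bad (w : {ffun 'I_D.+1 -> letter}) :=
  has (fun k => balance lam k (digits w) <= - (eta * k%:R)) (index_iota K E.+1).
have [|r [ru rJ hr]] := @mass_distribution R m n A Lambda m_gt1 m_lt_n A_neq0 carpetL
   lam s' (eta * K%:R - c) K E D J U kap (fun w => ~~ bad w) cov ED UJ _.
  move=> w k /hasPn hw /andP[Kk kE].
  have := hw k; rewrite mem_index_iota Kk ltnS kE => /(_ isT); rewrite -ltNge => hb.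
  rewrite log_ratioE (drift_shift _ s); have := dr k; rewrite Kk kE => /(_ isT) hd.
  have : eta * K%:R <= eta * k%:R by rewrite ler_pM2l // ler_nat.
  have : k%:R * ln n%:R * (s - s') = 2 * (eta * k%:R) by rewrite /eta; field.
  lra.
exists r; split => //; rewrite opprB in hr; apply: le_trans hr.
have h : \sum_(w | bad w) word_mass A lam w <= 2^-1 := K0P K E D lam KK ED lam01.
have := sum_word_mass A_neq0 D lam; rewrite (bigID bad) /=.
move: h; set a := \sum_(w | bad w) _; set b := \sum_(w | ~~ bad w) _; lra.
Qed.

End Estimates.

(** * Tilts of the blocks *)

Section Tilts.
Variables (R : realType) (I : finType) (C : {set I}) (x : I -> R).
Hypothesis C_neq0 : C != finset.set0.
Hypothesis nonconst : ~ {in C &, forall i j, x i = x j}.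
Variable g : R.
Hypothesis g_gt1 : 1 < g.

Local Notation mean := (tilt_mean C x).
Local Notation Lam := (logmgf C x).
Local Notation slope := (slope C x g).

(** The value of the Legendre transform at the mean of the tilt [l], which is
    the relative entropy of the tilted weights. *)
Definition tilt_rate (l : R) : R := l * mean l - Lam l.

(** At a root of [exponent] every slope up to the last one is the mean of a tilt
    in the unit interval. The sequence is completed by the tilt 0 of the columns
    after the last level and the tilt 1 of the levels up to the first one. *)
Lemma exists_tilt_sequence (r : R) (k : nat) (u : R) : 1 <= r < g ->
  mean 0 < u -> exponent C x g r k u = 0 ->
  exists lamv : nat -> R,
  [/\ forall j, 0 <= lamv j <= 1, {homo lamv : i j / (i <= j)%N >-> i <= j},
      lamv 0%N = 0 /\ lamv k.+2 = 1,
      forall j, (j <= k)%N -> mean (lamv j.+1) = u + g * tilt_rate (lamv j)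
    & mean (lamv k.+2) - tilt_rate (lamv k.+2) - u
        - (r - 1) * tilt_rate (lamv k.+1) - (g - r) * tilt_rate (lamv k) = 0].
Proof.
move=> rg mu e0.
have le1 j : (j <= k.+1)%N -> slope u j <= mean 1.
  by apply: (slope_le_mean1 C_neq0 nonconst g_gt1 rg (ltW mu)); rewrite e0.
have lt1 j : (j <= k)%N -> slope u j < slope u j.+1.
  by move=> jk; apply: (@slope_lt _ _ _ _ C_neq0 g g_gt1 k.+1) => //; exact: leqW.
have ge0 j : mean 0 <= slope u j.
  exact: (slope_mono (i := 0) C_neq0 g_gt1 (ltW mu) (leq0n j)).
have [|f fP] := @boolp.choice _ _ (fun j l => (j <= k.+1)%N ->
    0 <= l <= 1 /\ mean l = slope u j).
  move=> j; have [jk|jk] := leqP j k.+1; last by exists 0.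
  have [|l l01 ml] := @exists_tilt R I C x C_neq0 (slope u j); first by rewrite ge0 le1.
  by exists l.
pose lamv j := if j is 0%N then 0 else if (j <= k.+1)%N then f j else 1.
have lmean j : (j <= k.+1)%N -> mean (lamv j) = slope u j.
  by case: j => [//|j] jk; rewrite /lamv jk; have [] := fP j.+1 jk.
have l01 j : 0 <= lamv j <= 1.
  case: j => [|j] /=; first by rewrite lexx ler01.
  by case: ifP => [/fP[]//|_]; rewrite lexx ler01.
have rateE j : (j <= k.+1)%N -> tilt_rate (lamv j) = legendre01 C x (slope u j).
  by move=> jk; rewrite -lmean // legendre01_tilt.
have lk2 : lamv k.+2 = 1 by rewrite /lamv ltnn.
exists lamv; split => //.
- apply: homo_leq => [j|j i h|j]; first exact: lexx.
    exact: le_trans.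
  have [jk|kj] := leqP j k; last first.
    have -> : lamv j.+1 = 1 by rewrite /lamv ltnS leqNgt kj.
    by have /andP[] := l01 j.
  apply/ltW/(tilt_mean_lt_inv (x := x) C_neq0).
  by rewrite !lmean // ?lt1 // leqW.
- by move=> j jk; rewrite lmean // rateE ?leqW // slopeS.
- rewrite lk2 !rateE // ?leqW //.
  have -> : mean 1 - tilt_rate 1 = Lam 1 by rewrite /tilt_rate; ring.
  exact: e0.
Qed.

End Tilts.

Section CoverSums.
Variables (R : realType) (d : nat).

Lemma cover_sum_le (N : nat) (U : nat -> set 'rV[R]_d) (b : nat -> R) (s : R) :
  0 <= s -> (forall i, (i < N)%N -> (diam (U i) <= (b i)%:E)%E) ->
  (cover_sum `I_N U s <= (\sum_(i < N) b i `^ s)%:E)%E.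
Proof.
move=> s0 dU; rewrite /cover_sum esum_fset //; last by move=> i _; exact: poweR_ge0.
rewrite -fsbig_ord -sumEFin; apply: lee_sum => i _; rewrite -poweR_EFin.
apply: gt0_ler_poweR => //; first by rewrite in_itv /= diam_ge0 leey.
  by rewrite in_itv /= leey andbT (le_trans (diam_ge0 (U i))) // dU.
exact: dU.
Qed.

Lemma cover_sum_ge (J : set nat) (r : seq nat) (U : nat -> set 'rV[R]_d)
    (b : nat -> R) (s : R) :
  uniq r -> (forall i, i \in r -> J i) ->
  (forall i, J i -> ((b i)%:E <= (diam (U i) `^ s))%E) ->
  ((\sum_(i <- r) b i)%:E <= cover_sum J U s)%E.
Proof.
move=> ru rJ bU; apply: esum_ge; exists [set` r].
  by split; [exact: finite_seq|exact: rJ].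
rewrite -fsbig_seq // -sumEFin big_seq [leRHS]big_seq.
by apply: lee_sum => i /rJ; exact: bU.
Qed.

End CoverSums.

(** * Covers for the intermediate dimensions *)

Section ThetaCovers.
Variables (R : realType) (m n : nat) (A : {set 'I_m * 'I_n}).
Variable Lambda : set 'rV[R]_2.
Hypotheses (m_gt1 : (1 < m)%N) (m_lt_n : (m < n)%N).
Hypothesis A_neq0 : A != finset.set0.
Hypothesis carpetL : is_carpet A Lambda.
Hypothesis nonuniform : nonuniform_fibres A.

Local Notation letter := ('I_m * 'I_n)%type.
Local Notation lev := (level m n).
Local Notation C := (columns A).
Local Notation x := (log_size R A).
Local Notation mean := (tilt_mean C x).
Local Notation Lam := (logmgf C x).
Local Notation g := (carpet_gamma R m n).

Let n_gt1 : (1 < n)%N. Proof. exact: ltn_trans m_lt_n. Qed.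
Let lnn_gt0 : 0 < ln n%:R :> R. Proof. exact: ln_n_gt0 m_gt1 m_lt_n. Qed.
Let lnm_gt0 : 0 < ln m%:R :> R. Proof. exact: ln_m_gt0 m_gt1. Qed.
Let g_gt1 : 1 < g. Proof. exact: carpet_gamma_gt1 m_gt1 m_lt_n. Qed.
Let g_gt0 : 0 < g. Proof. exact: lt_trans g_gt1. Qed.
Let C_neq0 : C != finset.set0. Proof. exact: columns_neq0. Qed.

Lemma log_size_nonconst : ~ {in C &, forall i j, x i = x j}.
Proof.
move=> h; apply: nonuniform => i j iC jC.
have := congr1 expR (h i j iC jC).
by rewrite !expR_log_size // => /eqP; rewrite eqr_nat => /eqP.
Qed.

Variables (theta : R) (l : nat).
Hypotheses (theta_gt0 : 0 < theta) (theta_lt1 : theta < 1).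
Hypotheses (theta_gt : g ^- l.+1 < theta) (theta_le : theta <= g ^- l).

Local Notation r := ((theta * g ^+ l)^-1).

Lemma ratio_itv : 1 <= r < g.
Proof.
have gl : 0 < g ^+ l by apply: exprn_gt0.
have tg : 0 < theta * g ^+ l by apply: mulr_gt0.
apply/andP; split.
  rewrite -[leLHS]invr1 lef_pV2 ?posrE //.
  by move: theta_le; rewrite -[leRHS]div1r ler_pdivlMr.
rewrite -[ltRHS]invrK ltf_pV2 ?posrE ?invr_gt0 //.
by move: theta_gt; rewrite exprS invfM -ltr_pdivrMr.
Qed.

Variable u : R.
Hypotheses (u_gt : mean 0 < u) (u_root : exponent C x g r l u = 0).

Local Notation s := (u / ln n%:R + ln #|C|%:R / ln m%:R).

(** The tilts of the blocks for the first level [K] and the last level [E]. The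
    constant does not depend on [K] and [E]. *)
Lemma exists_balanced_tilts (a : R) : 0 <= a ->
  exists c : R, forall K E : nat, K%:R / theta <= E%:R <= K%:R / theta + a ->
  exists lam : nat -> R, [/\ forall q, 0 <= lam q <= 1,
    forall k, (K <= k <= E)%N -> `|drift A lam s k| <= c &
    forall w : nat -> letter, exists2 k, (K <= k <= E)%N & balance A lam k w <= 0].
Proof.
move=> a0; have rg := ratio_itv; have /andP[r1 r2] := rg.
have [lamv [l01 lhom [l0 l1] lrec lroot]] :=
  exists_tilt_sequence C_neq0 log_size_nonconst g_gt1 rg u_gt u_root.
pose tv j := mean (lamv j); pose Iv j := tilt_rate C x (lamv j).
exists (g * (\sum_(j < l) `|Iv j.+1 - Iv j|) + (a + 1) * `|Iv l.+1 - Iv l|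
  + ln #|C|%:R) => K E /andP[E1 E2].
have rK : r * K%:R * g ^+ l = K%:R / theta.
  by field; rewrite expf_neq0 ?gt_eqF.
have E_ge : r * K%:R * g ^+ l <= E%:R by rewrite rK.
have E_le : E%:R <= r * K%:R * g ^+ l + a by rewrite rK.
pose bl := block (breakpoint g l K E) l.+2.
have KE := leq_KE g_gt1 r1 E_ge.
exists (fun q => lamv (bl q)); split => //.
- move=> k /andP[Kk kE].
  have I0 : Iv 0%N = 0 by rewrite /Iv l0 /tilt_rate mul0r logmgf0 // subr0.
  have := @block_balance R g r l g_gt1 r1 K E E_ge lev (level_itv R m_gt1 m_lt_n) r2
    tv Iv u a a0 E_le I0 lrec lroot k.
  rewrite Kk kE => /(_ isT) h; rewrite /drift.
  have -> : \sum_(q < k) mean (lamv (bl q)) -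
      \sum_(q < lev k) (lamv (bl q) * mean (lamv (bl q)) - Lam (lamv (bl q))) +
      (lev k)%:R * ln #|C|%:R - k%:R * ln n%:R * s =
    (\sum_(q < k) tv (bl q) - \sum_(q < lev k) Iv (bl q) - k%:R * u) +
    ((lev k)%:R - g * k%:R) * ln #|C|%:R.
    rewrite /carpet_gamma; field.
    by rewrite !gt_eqF.
  apply: (le_trans (ler_normD _ _)); apply: lerD => //.
  have M0 : 0 <= ln #|C|%:R :> R by rewrite ln_ge0 // ler1n card_gt0.
  rewrite normrM (ger0_norm M0) ler_piMl //.
  have [h1 h2] := level_itv R m_gt1 m_lt_n k.
  by rewrite ler_norml; lra.
- move=> w.
  exact: (exists_balanced_level (breakpoint_antitone g_gt1 r1 E_ge)
    (fun q => x (w q).1 - mean (lamv (bl q))) lhom l0 l1 KE (leq_level m_gt1 m_lt_n)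
    (breakpoint_bounds g_gt1 r1 E_ge)).
Qed.

Let s_gt0 : 0 < s.
Proof.
have u0 : 0 < u.
  by apply: le_lt_trans u_gt; have /andP[] := tilt_mean_bounds A_neq0 (0 : R).
rewrite ltr_pwDl ?divr_gt0 // divr_ge0 ?(ltW lnm_gt0) // ln_ge0 //.
by rewrite ler1n card_gt0.
Qed.

Local Notation lnn := (ln n%:R : R).

(** The squares of the balanced levels, enlarged when their diameter would be
    less than [delta^(1/theta)]. For the exponent [s'] their cost has the
    additional factor [n^-(K (s' - s))], which outweighs the number of levels. *)
Lemma theta_cover_above (s' eps : R) : s < s' -> 0 < eps ->
  exists2 delta0, 0 < delta0 & forall delta, 0 < delta -> delta <= delta0 ->
    theta_cover theta Lambda s' eps delta.
Proof.
move=> ss' e0; have s'0 : 0 < s' by apply: lt_trans ss'.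
have [c cP] := exists_balanced_tilts ler01.
have th0 := theta_gt0; have th1 := theta_lt1.
have itheta : 1 < theta^-1 by rewrite invf_gt1.
(* The side length of the squares of level [k] is at most [exp c1 * n^-k]. *)
pose c1 := (3 * theta^-1 + 1) * lnn.
pose beta := (s' - s) * lnn.
have beta0 : 0 < beta by rewrite mulr_gt0 // subr_gt0.
pose c2 := expR (s' * (ln 2 + c1)) * expR c.
have c20 : 0 < c2 by rewrite mulr_gt0 // expR_gt0.
have [||K0 K0P] := @linear_exp_small R (c2 * theta^-1) (c2 * 2) beta eps _ _ beta0 e0.
- by rewrite mulr_ge0 ?(ltW c20) // invr_ge0 ltW.
- by rewrite mulr_ge0 // ltW.
(* The second bound makes [2 * delta^(1/theta)] at most [delta]. *)
pose y := Num.max (K0%:R * lnn) (ln 2 / (theta^-1 - 1)).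
exists (expR (- y)); first exact: expR_gt0.
move=> delta d0 dle.
have lnd : ln delta <= - y by rewrite -ler_expR lnK.
have y0 : 0 <= y.
  by rewrite le_max; apply/orP; left; rewrite mulr_ge0 // ltW.
pose T := - ln delta / lnn.
have T0 : 0 <= T by rewrite divr_ge0 ?(ltW lnn_gt0) // lerNr oppr0 (le_trans lnd) // oppr_le0.
have /andP[tr1 tr2] := truncn_itv T0; set tr := Num.truncn T in tr1 tr2.
have dT : ln delta = - (T * lnn) by rewrite /T divfK ?gt_eqF // opprK.
(* With three more levels, squares of side [n * n^-K] have diameter at most
   [delta]. *)
pose K := (tr + 3)%N.
have KR : K%:R = tr%:R + 3 :> R by rewrite natrD.
have KK0 : (K0 <= K)%N.
  rewrite -(ler_nat R) KR; apply: (@le_trans _ _ T); last first.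
    by move: tr2; rewrite -natr1; lra.
  rewrite /T ler_pdivlMr // lerNr; apply: (le_trans lnd); rewrite lerN2.
  by rewrite le_max lexx.
have d2 : ln 2 + ln delta * theta^-1 <= ln delta.
  have : ln 2 / (theta^-1 - 1) <= - ln delta.
    by rewrite lerNr; apply: (le_trans lnd); rewrite lerN2 le_max lexx orbT.
  rewrite ler_pdivrMr ?subr_gt0 //; lra.
pose E := (Num.truncn (K%:R / theta : R)).+1.
have EP : K%:R / theta <= E%:R <= K%:R / theta + 1.
  have := @truncn_itv R (K%:R / theta).
  rewrite divr_ge0 ?(ltW th0) // => /(_ isT)/andP[h1 h2].
  by rewrite ltW //= /E -natr1 lerD2r.
have [lam [l01 dr bal]] := cP K E EP.
pose side k : R := Num.max (n%:R * (n%:R ^+ k)^-1) (delta `^ theta^-1).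
have powE k : (n%:R ^+ k)^-1 = expR (- (k%:R * lnn)) :> R by rewrite (expR_level R m_gt1 m_lt_n).
have nE : n%:R = expR lnn :> R by rewrite lnK // posrE ltr0n ltnW.
have dE : delta `^ theta^-1 = expR (ln delta * theta^-1).
  by rewrite /powR gt_eqF // mulrC.
have delE : delta = expR (ln delta) by rewrite lnK.
have e2 : 2 = expR (ln 2) :> R by rewrite lnK // posrE.
have [||N [U [kap [cov UP sumP]]]] := @cover_by_squares R m n A Lambda m_gt1 m_lt_n
  A_neq0 carpetL lam s c K E (lev E) side (leqnSn _).
- move=> w _; have [k kKE hk] := bal w; exists k => //.
  by rewrite log_ratioE; have := dr k kKE; rewrite ler_norml; lra.
- move=> k _; rewrite le_max; apply/orP; left.
  by rewrite ler_wpM2r ?ler_nat ?(ltnW m_lt_n) // invr_ge0 exprn_ge0.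
exists `I_N, U.
have side_lb k : delta `^ theta^-1 <= side k by rewrite le_max lexx orbT.
have side_ub k : (K <= k)%N -> 2 * side k <= delta.
  move=> Kk; rewrite /side -[X in X <= _]mulrC maxr_pMl // ge_max; apply/andP; split.
    rewrite powE [in X in X * _ * _]nE {1}e2 -!expRD [leRHS]delE ler_expR dT.
    have h2 : ln 2 <= lnn by rewrite ler_ln ?posrE ?ltr0n ?ler_nat // ltnW.
    have h3 : T * lnn <= (tr%:R + 1) * lnn by rewrite ler_pM2r // natr1 ltW.
    have h4 : (tr%:R + 3) * lnn <= k%:R * lnn by rewrite ler_pM2r // -KR ler_nat.
    lra.
  by rewrite dE {1}e2 -expRD [leRHS]delE ler_expR; lra.
split => //.
- move=> i /= /UP [/andP[Kk kE] /andP[h1 h2]]; split.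
    by apply: le_trans h1; rewrite lee_fin.
  by apply: (le_trans h2); rewrite lee_fin side_ub.
have dUi i : (i < N)%N -> (diam (U i) <= (2 * side (kap i))%:E)%E.
  by move=> /UP [_ /andP[]].
apply: le_trans (cover_sum_le (ltW s'0) dUi) _; rewrite lee_fin.
apply: (@le_trans _ _ (\sum_(i < N) expR (s' * (ln 2 + c1)) *
   expR (- (beta * K%:R)) * expR (- ((kap i)%:R * lnn) * s))).
  apply: ler_sum => i _; have [/andP[Kk kE] _] := UP i (ltn_ord i).
  set k := kap i in Kk kE *.
  have sk : 2 * side k <= expR (ln 2 + c1 - k%:R * lnn).
    rewrite -addrA expRD -e2 ler_pM2l // /side ge_max; apply/andP; split.
      rewrite powE nE -expRD ler_expR /c1 -nE.
      have : 0 <= 3 * theta^-1 * lnn by rewrite !mulr_ge0 ?(ltW lnn_gt0) // invr_ge0 ltW.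
      lra.
    rewrite dE ler_expR dT /c1.
    have h1 : k%:R * lnn <= (K%:R * theta^-1 + 1) * lnn.
      by rewrite ler_pM2r // (le_trans _ (andP EP).2) // ler_nat.
    have h2 : tr%:R * (lnn * theta^-1) <= T * (lnn * theta^-1).
      by rewrite ler_wpM2r // mulr_ge0 ?(ltW lnn_gt0) // invr_ge0 ltW.
    have h3 : K%:R * theta^-1 * lnn = tr%:R * (lnn * theta^-1) + 3 * theta^-1 * lnn.
      by rewrite KR; ring.
    lra.
  have sk0 : 0 <= side k by apply: le_trans (side_lb k); apply: powR_ge0.
  apply: (@le_trans _ _ (expR (ln 2 + c1 - k%:R * lnn) `^ s')).
    by apply: ge0_ler_powR; rewrite ?nnegrE ?expR_ge0 ?mulr_ge0 // ltW.
  rewrite -expRM -!expRD ler_expR /beta.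
  have : (s' - s) * (K%:R * lnn) <= (s' - s) * (k%:R * lnn).
    by rewrite ler_pM2l ?subr_gt0 // ler_pM2r // ler_nat.
  lra.
rewrite -mulr_sumr; apply: le_trans (K0P K KK0).
have Eh : (E.+1 - K)%:R <= theta^-1 * K%:R + 2 :> R.
  apply: (@le_trans _ _ E.+1%:R); first by rewrite ler_nat leq_subr.
  by move: EP => /andP[_]; rewrite -natr1 mulrC; lra.
apply: (@le_trans _ _ (expR (s' * (ln 2 + c1)) * expR (- (beta * K%:R)) *
   ((E.+1 - K)%:R * expR c))).
  by rewrite ler_wpM2l // mulr_ge0 // expR_ge0.
have -> : (c2 * theta^-1 * K%:R + c2 * 2) * expR (- (beta * K%:R)) =
  expR (s' * (ln 2 + c1)) * expR (- (beta * K%:R)) *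
   ((theta^-1 * K%:R + 2) * expR c) by rewrite /c2; ring.
by rewrite ler_wpM2l ?mulr_ge0 ?expR_ge0 // ler_wpM2r ?expR_ge0.
Qed.

(** A set of the cover is assigned the level at which [n^-k] is comparable with
    its diameter. *)
Lemma theta_cover_below (s' : R) : 0 <= s' -> s' < s ->
  exists2 delta0, 0 < delta0 & forall delta, 0 < delta -> delta <= delta0 ->
    ~ theta_cover theta Lambda s' 1 delta.
Proof.
move=> s'0 ss'; have th0 := theta_gt0.
have a0 : 0 <= theta^-1 + 1 by rewrite addr_ge0 // invr_ge0 ltW.
have [c cP] := exists_balanced_tilts a0.
have [K0 K0P] := cover_cost_lower_bound m_gt1 m_lt_n A_neq0 carpetL ss'.
pose eta := (s - s') * lnn / 2.
have eta0 : 0 < eta by rewrite divr_gt0 // mulr_gt0 // subr_gt0.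
pose c2 := 25%:R * expR (c + s' * lnn).
have c20 : 0 <= c2 by rewrite mulr_ge0 // expR_ge0.
have [|K1 K1P] := @linear_exp_small R 0 c2 eta 4^-1 (lexx 0) c20 eta0.
  by rewrite invr_gt0.
exists (expR (- (maxn K0 K1)%:R * lnn)); first exact: expR_gt0.
move=> delta d0 dle [J [U [cov UJ sumU]]].
have lnd : ln delta <= - (maxn K0 K1)%:R * lnn by rewrite -ler_expR lnK.
pose T := - ln delta / lnn.
have TK : (maxn K0 K1)%:R <= T by rewrite /T ler_pdivlMr // lerNr -mulNr.
have T0 : 0 <= T by apply: le_trans TK.
have /andP[tr1 tr2] := truncn_itv T0; set K := Num.truncn T in tr1 tr2.
have dT : ln delta = - (T * lnn) by rewrite /T divfK ?gt_eqF // opprK.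
have KK : (maxn K0 K1 <= K)%N by rewrite /K truncn_ge_nat.
have [KK0 KK1] : (K0 <= K)%N /\ (K1 <= K)%N.
  by move: KK; rewrite geq_max => /andP.
pose E := (Num.truncn (K.+1%:R / theta : R)).+1.
have /andP[E1 E2] : (Num.truncn (K.+1%:R / theta : R))%:R <= K.+1%:R / theta < E%:R.
  by apply: truncn_itv; rewrite divr_ge0 // ltW.
have EP : K%:R / theta <= E%:R <= K%:R / theta + (theta^-1 + 1).
  have e : K.+1%:R / theta = K%:R / theta + theta^-1 by rewrite -natr1 mulrDl mul1r.
  have : 0 < theta^-1 by rewrite invr_gt0.
  have eE : E%:R = (Num.truncn (K.+1%:R / theta : R))%:R + 1 :> R by rewrite natr1.
  by move: E1 E2; rewrite eE; set t := (Num.truncn _)%:R; rewrite e; lra.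
have [lam [l01 dr _]] := cP K E EP.
pose D i := fine (diam (U i)).
have DU i : J i -> diam (U i) = (D i)%:E.
  move=> /UJ [_ h2]; rewrite fineK // ge0_fin_numE ?diam_ge0 //.
  by apply: le_lt_trans h2 _; rewrite ltry.
have Dlb i : J i -> ln delta * theta^-1 <= ln (D i).
  move=> Ji; have [h1 _] := UJ i Ji; move: h1; rewrite DU // lee_fin => h1.
  rewrite mulrC -ln_powR ler_ln ?posrE ?powR_gt0 //.
  by apply: lt_le_trans h1; apply: powR_gt0.
have D0 i : J i -> 0 < D i.
  move=> Ji; have [h1 _] := UJ i Ji; move: h1; rewrite DU // lee_fin.
  by apply: lt_le_trans; apply: powR_gt0.
have Dub i : J i -> ln (D i) <= ln delta.
  move=> Ji; have [_ h1] := UJ i Ji; move: h1; rewrite DU // lee_fin => h1.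
  by rewrite ler_ln ?posrE // D0.
pose kap i := Num.truncn (- ln (D i) / lnn).
have kapP i : J i -> (kap i)%:R <= - ln (D i) / lnn < (kap i).+1%:R.
  move=> Ji; apply: truncn_itv; rewrite divr_ge0 ?(ltW lnn_gt0) // oppr_ge0.
  by apply: le_trans (Dub i Ji) _; rewrite dT oppr_le0 mulr_ge0 ?(ltW lnn_gt0).
have powE k : (n%:R ^+ k)^-1 = expR (- (k%:R * lnn)) :> R by rewrite (expR_level R m_gt1 m_lt_n).
have [||r [ru rJ hr]] := K0P K E lam c J U kap KK0 l01 _ cov.
- by move=> k kKE; have := dr k kKE; rewrite ler_norml => /andP[].
- move=> i Ji; have /andP[k1 k2] := kapP i Ji; split.
    apply/andP; split.
      rewrite /K /kap le_truncn // /T ler_pM2r ?invr_gt0 // lerN2; exact: Dub.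
    rewrite /E; apply: leqW; rewrite truncn_ge_nat; last by rewrite divr_ge0 // ltW.
    apply: (le_trans k1); rewrite ler_pdivrMr //.
    have h := Dlb i Ji; rewrite dT in h.
    apply: (@le_trans _ _ (T * lnn * theta^-1)); first lra.
    rewrite mulrAC ler_pM2r // ler_pM2r ?invr_gt0 //; exact: ltW.
  rewrite DU // lee_fin powE -[leLHS]lnK ?posrE ?D0 // ler_expR.
  by move: k1; rewrite ler_pdivlMr //; lra.
pose b i := expR (- ((kap i)%:R * lnn) * s') * expR (- (s' * lnn)).
have bU i : J i -> ((b i)%:E <= (diam (U i) `^ s'))%E.
  move=> Ji; rewrite DU // poweR_EFin lee_fin /b -expRD.
  rewrite /powR gt_eqF ?D0 // ler_expR; have /andP[_ k2] := kapP i Ji.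
  have : - ln (D i) * s' <= ((kap i).+1%:R * lnn) * s'.
    by rewrite ler_wpM2r // -ler_pdivrMr // ltW.
  by rewrite -natr1; lra.
have := le_trans (cover_sum_ge ru rJ bU) sumU; rewrite lee_fin -mulr_suml => h1.
have h2 : \sum_(i <- r) expR (- ((kap i)%:R * lnn) * s') <= expR (s' * lnn).
  by move: h1; rewrite expRN ler_pdivrMr ?expR_gt0 // mul1r.
have h3 : 25%:R * expR (c - eta * K%:R) * \sum_(i <- r) expR (- ((kap i)%:R * lnn) * s')
   <= 4^-1.
  apply: le_trans (K1P K KK1); rewrite mul0r add0r /c2.
  have -> : 25%:R * expR (c + s' * lnn) * expR (- (eta * K%:R)) =
    25%:R * expR (c - eta * K%:R) * expR (s' * lnn).
    by rewrite -!mulrA -!expRD; congr (_ * expR _); ring.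
  by rewrite ler_wpM2l // mulr_ge0 // expR_ge0.
have h4 : 2^-1 <= 4^-1 :> R := le_trans hr h3.
lra.
Qed.

End ThetaCovers.

(** * Box dimension *)

Section BoxDimension.
Variables (R : realType) (m n : nat) (A : {set 'I_m * 'I_n}).
Variable Lambda : set 'rV[R]_2.
Hypotheses (m_gt1 : (1 < m)%N) (m_lt_n : (m < n)%N).
Hypothesis A_neq0 : A != finset.set0.
Hypothesis carpetL : is_carpet A Lambda.

Local Notation letter := ('I_m * 'I_n)%type.
Local Notation lev := (level m n).
Local Notation C := (columns A).
Local Notation x := (log_size R A).
Local Notation Lam := (logmgf C x).
Local Notation g := (carpet_gamma R m n).
Local Notation lnn := (ln n%:R : R).
Local Notation logM := (ln #|C|%:R : R).

Let n_gt1 : (1 < n)%N. Proof. exact: ltn_trans m_lt_n. Qed.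
Let lnn_gt0 : 0 < lnn. Proof. exact: ln_n_gt0 m_gt1 m_lt_n. Qed.
Let lnm_gt0 : 0 < ln m%:R :> R. Proof. exact: ln_m_gt0 m_gt1. Qed.
Let C_neq0 : C != finset.set0. Proof. exact: columns_neq0. Qed.
Let logM_ge0 : 0 <= logM. Proof. by rewrite ln_ge0 // ler1n card_gt0. Qed.

(** The logarithm of the number of approximate squares of level [k]. *)
Definition log_count (k : nat) : R := k%:R * Lam 1 + (lev k)%:R * logM.

(** With tilt 1 up to level [k] and tilt 0 afterwards, the mass is uniform on
    the approximate squares of level [k]. *)
Lemma log_ratio_uniform k (w : nat -> letter) :
  log_ratio A (fun q => (q < k)%:R) 0 k w = log_count k.
Proof.
have kl := leq_level m_gt1 m_lt_n k.
rewrite /log_ratio /log_cell_mass mulr0 sub0r /log_count.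
have -> : \sum_(q < lev k) ((q < k)%:R * x (w q).1 - Lam (q < k)%:R - logM) =
  \sum_(q < k) (x (w q).1 - Lam 1) - (lev k)%:R * logM.
  rewrite sumrB sumr_const card_ord -[logM *+ _]mulr_natl; congr (_ - _).
  rewrite (big_ord_widen _ (fun q => x (w q).1 - Lam 1) kl) [RHS]big_mkcond.
  by apply: eq_bigr => q _; case: ltnP; rewrite /= ?mul1r // mul0r logmgf0 // subr0.
by rewrite sumrB sumr_const card_ord -[Lam 1 *+ k]mulr_natl; ring.
Qed.

Local Notation dimB := (Lam 1 / lnn + logM / ln m%:R).

Lemma log_count_bounds k :
  k%:R * lnn * dimB - logM <= log_count k <= k%:R * lnn * dimB.
Proof.
have -> : k%:R * lnn * dimB = k%:R * Lam 1 + (g * k%:R) * logM.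
  by rewrite /carpet_gamma; field; rewrite !gt_eqF.
have [h1 h2] := level_itv R m_gt1 m_lt_n k.
rewrite /log_count; apply/andP; split.
  have : (g * k%:R) * logM <= ((lev k)%:R + 1) * logM by rewrite ler_wpM2r // ltW.
  lra.
by rewrite lerD2l ler_wpM2r.
Qed.

Lemma covering_number_le k (delta : R) : 2 * (n%:R * (n%:R ^+ k)^-1) <= delta ->
  (covering_number Lambda delta <= (expR (log_count k))%:E)%E.
Proof.
move=> hd.
have [|| N [U [kap [cov UP sumP]]]] := @cover_by_squares R m n A Lambda m_gt1 m_lt_n
  A_neq0 carpetL (fun q => (q < k)%:R) 0 (log_count k) k k (lev k)
  (fun k => n%:R * (n%:R ^+ k)^-1) (leqnSn _).
- by move=> w _; exists k; rewrite ?leqnn // log_ratio_uniform.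
- by move=> j _; rewrite ler_wpM2r ?ler_nat ?(ltnW m_lt_n) // invr_ge0 exprn_ge0.
move: sumP; rewrite subSnn mul1r.
under eq_bigr do rewrite mulr0 expR0.
rewrite sumr_const card_ord => hN.
apply: (@le_trans _ _ N%:R%:E); last by rewrite lee_fin.
apply: ereal_inf_lbound; exists N => //; exists U; split => // i /UP.
move=> [kk /andP[_ h]]; apply: (le_trans h); rewrite lee_fin.
suff -> : kap i = k by [].
by apply/eqP; rewrite eqn_leq andbC.
Qed.

(** Mass distribution for the uniform mass and the exponent 0. *)
Lemma covering_number_ge k (delta : R) : delta <= (n%:R ^+ k)^-1 ->
  ((expR (log_count k) / 25%:R)%:E <= covering_number Lambda delta)%E.
Proof.
move=> hd; apply: le_ereal_inf_tmp => _ [N [U [cov dU]] <-]; rewrite lee_fin.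
have [||r [ru rJ]] := @mass_distribution R m n A Lambda m_gt1 m_lt_n A_neq0 carpetL
  (fun q => (q < k)%:R) 0 (log_count k) k k (lev k) `I_N U (fun=> k) predT cov (leqnSn _).
- move=> i /= iN; rewrite leqnn; split => //; apply: le_trans (dU i iN) _.
  by rewrite lee_fin.
- move=> w j _; rewrite -eqn_leq => /eqP <-; by rewrite log_ratio_uniform.
rewrite sum_word_mass // mulr0 expR0 big_const_seq count_predT iter_addr_0.
move=> h; have rN : (size r <= N)%N.
  by rewrite -[leqRHS](size_iota 0); apply: uniq_leq_size => // i /rJ /=; rewrite mem_iota.
rewrite ler_pdivrMr // -(ler_pM2r (expR_gt0 (- log_count k))) -expRD subrr expR0.
apply: (le_trans h); rewrite mulrC mulrA; apply: ler_wpM2r; first exact: expR_ge0.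
by rewrite ler_wpM2r // ler_nat.
Qed.

Lemma box_dim_carpet : box_dim Lambda = dimB%:E.
Proof.
have dimB0 : 0 <= dimB.
  apply: addr_ge0; last by rewrite divr_ge0 // ltW.
  rewrite divr_ge0 ?(ltW lnn_gt0) //.
  have := logmgf_tangent x C_neq0 0 1; rewrite logmgf0 // add0r subr0 mul1r.
  by apply: le_trans; have /andP[] := tilt_mean_bounds A_neq0 (0 : R).
apply: cvg_lim => //; apply/fine_cvgP.
pose c := 3 * lnn * dimB + logM + ln 25%:R.
have c0 : 0 <= c.
  by rewrite !addr_ge0 // ?ln_ge0 ?ler1n // !mulr_ge0 // ltW // lnn_gt0.
have key delta : 0 < delta -> delta < 1 -> exists2 v : R,
   (lne (covering_number Lambda delta) * ((- ln delta)^-1)%:E)%E = v%:E &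
   `|v - dimB| <= c / - ln delta.
  move=> d0 d1; have lnd : ln delta < 0 by rewrite ln_lt0 // d0.
  pose T := - ln delta / lnn.
  have T0 : 0 <= T by rewrite divr_ge0 ?(ltW lnn_gt0) // oppr_ge0 ltW.
  have /andP[tr1 tr2] := truncn_itv T0; set tr := Num.truncn T in tr1 tr2.
  have dT : - ln delta = T * lnn by rewrite /T divfK ?gt_eqF.
  have powE k : (n%:R ^+ k)^-1 = expR (- (k%:R * lnn)) :> R by rewrite (expR_level R m_gt1 m_lt_n).
  have nE : n%:R = expR lnn :> R by rewrite lnK // posrE ltr0n ltnW.
  have delE : delta = expR (ln delta) by rewrite lnK.
  have lo := @covering_number_ge tr delta.
  have hi := @covering_number_le (tr + 3)%N delta.
  have {}lo := lo _.
  have h1 : delta <= (n%:R ^+ tr)^-1.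
    rewrite powE [leLHS]delE ler_expR lerNr dT.
    by rewrite ler_pM2r.
  have h2 : 2 * (n%:R * (n%:R ^+ (tr + 3)%N)^-1) <= delta.
    have e2 : 2 = expR (ln 2) :> R by rewrite lnK // posrE.
    rewrite powE [in X in 2 * (X * _)]nE {1}e2 -!expRD [leRHS]delE ler_expR.
    rewrite -[ln delta]opprK dT natrD.
    have l2 : ln 2 <= lnn by rewrite ler_ln ?posrE ?ltr0n ?ler_nat // ltnW.
    have : T * lnn <= (tr%:R + 1) * lnn by rewrite ler_pM2r // natr1 ltW.
    by clear h1 lo hi d0 d1 lnd T0 tr1 tr2 dT delE dimB0 c0; lra.
  move: (lo h1) (hi h2); case: covering_number => [v||] //; rewrite !lee_fin => v1 v2.
  have v0 : 0 < v by apply: lt_le_trans v1; rewrite divr_gt0 ?expR_gt0.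
  exists (ln v / - ln delta); first by rewrite lne_EFin // -EFinM.
  have nlnd : 0 < - ln delta by rewrite oppr_gt0.
  have -> : ln v / - ln delta - dimB = (ln v - T * lnn * dimB) / - ln delta.
    by rewrite -dT mulrBl mulrAC divff ?mul1r // gt_eqF.
  rewrite normrM (ger0_norm (_ : 0 <= (- ln delta)^-1)) ?invr_ge0 ?(ltW nlnd) //.
  rewrite ler_pM2r ?invr_gt0 //.
  have lv1 : log_count tr - ln 25%:R <= ln v.
    rewrite -(expRK (log_count tr)) -ln_div ?posrE ?expR_gt0 //.
    by rewrite ler_ln ?posrE ?divr_gt0 ?expR_gt0.
  have lv2 : ln v <= log_count (tr + 3)%N.
    by rewrite -ler_expR lnK.
  have /andP[b1 _] := log_count_bounds tr.
  have /andP[_ b2] := log_count_bounds (tr + 3)%N.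
  have t1 : T * lnn * dimB <= (tr%:R + 1) * lnn * dimB.
    by rewrite ler_wpM2r // ler_pM2r // natr1 ltW.
  have t2 : (tr + 3)%:R * lnn * dimB <= (T + 3) * lnn * dimB.
    by rewrite ler_wpM2r // ler_pM2r // natrD lerD2r.
  have l25 : 0 <= ln 25%:R :> R by rewrite ln_ge0 // ler1n.
  have p0 : 0 <= lnn * dimB by rewrite mulr_ge0 // ltW // lnn_gt0.
  have M0 := logM_ge0; move: b1 b2 t1 t2 p0 lv1 lv2 l25 M0.
  rewrite ler_norml /c natrD.
  move: (dimB) (ln v) (log_count tr) (log_count (tr + 3)%N) => d lv p q.
  move: (ln 25%:R) logM (T) lnn (tr%:R : R) => e f t a k; clear.
  by move=> *; apply/andP; split; lra.
split.
  near=> delta.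
  have [||v -> _] := key delta; [by near: delta; exact: nbhs_right_gt|
    by near: delta; exact: nbhs_right_lt|by []].
apply/cvgrPdist_le => e e0 /=; near=> delta.
have d0 : 0 < delta by near: delta; exact: nbhs_right_gt.
have d1 : delta < 1 by near: delta; exact: nbhs_right_lt.
have [v -> hv] := key delta d0 d1; rewrite /= distrC.
apply: (le_trans hv); rewrite ler_pdivrMr ?oppr_gt0 ?ln_lt0 ?d0 //.
rewrite -ler_pdivrMl // lerNr -ler_expR lnK //.
by near: delta; apply: nbhs_right_ltW; apply: expR_gt0.
Unshelve. all: by end_near. Qed.

End BoxDimension.

(** * Lower bound for the Hausdorff dimension *)

Section HausdorffLowerBound.
Variables (R : realType) (m n : nat) (A : {set 'I_m * 'I_n}).
Variable Lambda : set 'rV[R]_2.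
Hypotheses (m_gt1 : (1 < m)%N) (m_lt_n : (m < n)%N).
Hypothesis A_neq0 : A != finset.set0.
Hypothesis carpetL : is_carpet A Lambda.

Local Notation lev := (level m n).
Local Notation C := (columns A).
Local Notation x := (log_size R A).
Local Notation mean := (tilt_mean C x).
Local Notation lnn := (ln n%:R : R).
Local Notation logM := (ln #|C|%:R : R).

Let n_gt1 : (1 < n)%N. Proof. exact: ltn_trans m_lt_n. Qed.
Let lnn_gt0 : 0 < lnn. Proof. exact: ln_n_gt0 m_gt1 m_lt_n. Qed.
Let lnm_gt0 : 0 < ln m%:R :> R. Proof. exact: ln_m_gt0 m_gt1. Qed.
Let C_neq0 : C != finset.set0. Proof. exact: columns_neq0. Qed.
Let logM_ge0 : 0 <= logM. Proof. by rewrite ln_ge0 // ler1n card_gt0. Qed.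

(** Open enlargement, which makes countable covers of the carpet finite. *)
Definition thicken (U : set 'rV[R]_2) (rho : R) : set 'rV[R]_2 :=
  \bigcup_(p in U) ball p rho.

Lemma open_thicken U rho : open (thicken U rho).
Proof.
by apply: bigcup_open => p _; exact: ball_open.
Qed.

Lemma sub_thicken U rho : 0 < rho -> U `<=` thicken U rho.
Proof. by move=> r0 p Up; exists p => //; exact: ballxx. Qed.

Lemma diam_thicken U (rho d : R) : 0 < rho -> (diam U <= d%:E)%E ->
  (diam (thicken U rho) <= (2 * d + 4 * rho)%:E)%E.
Proof.
move=> r0 dU; have d0 : 0 <= d by rewrite -lee_fin (le_trans (diam_ge0 U)).
apply: diam_le; first by rewrite addr_ge0 ?mulr_ge0 // ltW.
move=> p q [p' Up' +] [q' Uq']; rewrite -ball_normE /= => bp bq.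
have dd : Defs.edist p' q' <= d.
  by rewrite -lee_fin (le_trans (edist_le_diam Up' Uq')).
apply: (le_trans (edist_le_coord p q)).
have h (i : 'I_2) : `|p 0 i - q 0 i| <= d + 2 * rho.
  have h1 := le_trans (edist_ge_coord p' q' i) dd.
  have h2 : `|p' 0 i - p 0 i| <= rho.
    by have := coord_le_norm (p' - p) i; rewrite !mxE => /le_trans; apply; exact: ltW.
  have h3 : `|q' 0 i - q 0 i| <= rho.
    by have := coord_le_norm (q' - q) i; rewrite !mxE => /le_trans; apply; exact: ltW.
  move: h1 h2 h3; rewrite !ler_norml => /andP[? ?] /andP[? ?] /andP[? ?].
  by apply/andP; split; lra.
have := h ord0; have := h ord_max; lra.
Qed.

(** A set of diameter [d] is enclosed in sets of diameter [n^-k] whose cost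
    [n^-(k s)] is comparable with [d^s], up to any error when [d] is [0]. *)
Lemma exists_enclosing_level (s d eps : R) (K : nat) : 0 <= s -> 0 <= d -> 0 < eps ->
  4 * d <= (n%:R ^+ K)^-1 ->
  exists k, [/\ (K <= k)%N, 4 * d <= (n%:R ^+ k)^-1 &
    expR (- (k%:R * lnn) * s) <= expR ((ln 4 + lnn) * s) * d `^ s + eps].
Proof.
move=> s0 d0 e0 dK.
have powE k : (n%:R ^+ k)^-1 = expR (- (k%:R * lnn)) :> R by rewrite (expR_level R m_gt1 m_lt_n).
have l4 : 0 <= ln 4 :> R by rewrite ln_ge0 // ler1n.
move: d0; rewrite le_eqVlt => /predU1P[<-|d0].
  have [s00|s00] := eqVneq s 0.
    exists K; rewrite leqnn mulr0 s00 !mulr0 expR0 powRr0 mulr1 invr_ge0 exprn_ge0 //.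
    by split => //; rewrite lerDl ltW.
  have sp : 0 < s by rewrite lt_neqAle eq_sym s00.
  have [K1 K1P] := @linear_exp_small R 0 1 (lnn * s) eps (lexx 0) ler01
    (mulr_gt0 lnn_gt0 sp) e0.
  exists (maxn K K1); rewrite leq_maxl mulr0 invr_ge0 exprn_ge0 //; split => //.
  have := K1P (maxn K K1) (leq_maxr _ _); rewrite mul0r add0r mul1r powR0 // mulr0 add0r.
  by apply: le_trans; rewrite ler_expR; lra.
pose T := - ln (4 * d) / lnn.
have d4 : 0 < 4 * d by rewrite mulr_gt0.
have TK : K%:R <= T.
  by rewrite /T ler_pdivlMr // lerNr -ler_expR lnK // -powE.
have /andP[k1 k2] := truncn_itv (le_trans (ler0n _ _) TK).
exists (Num.truncn T); split; first by rewrite truncn_ge_nat // (le_trans _ TK).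
  rewrite powE -[leLHS]lnK // ler_expR lerNr; by rewrite -ler_pdivlMr.
rewrite -[leLHS]addr0; apply: lerD; last exact: ltW.
rewrite /powR gt_eqF // -expRD ler_expR.
have lnd : ln (4 * d) = ln 4 + ln d by rewrite lnM ?posrE.
have h : - ln (4 * d) <= ((Num.truncn T)%:R + 1) * lnn.
  by rewrite -ler_pdivrMr // natr1 ltW.
have : - (ln 4 + ln d) * s <= ((Num.truncn T)%:R + 1) * lnn * s.
  by rewrite ler_wpM2r // -lnd.
lra.
Qed.

Lemma sum_geometric_half (r : seq nat) : uniq r ->
  \sum_(i <- r) (2^-1 : R) ^+ i.+1 <= 1.
Proof.
move=> ru; pose N := (\max_(i <- r) i).+1.
have rN i : i \in r -> (i < N)%N.
  by move=> ir; rewrite ltnS (big_rem i) //= leq_maxl.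
apply: (@le_trans _ _ (\sum_(i <- iota 0 N) (2^-1 : R) ^+ i.+1)).
  rewrite [leRHS](bigID (mem r)) /= -[X in _ <= X + _]big_filter.
  have -> : \sum_(i <- r) (2^-1 : R) ^+ i.+1 =
      \sum_(i <- [seq i <- iota 0 N | i \in r]) 2^-1 ^+ i.+1.
    apply: perm_big; apply: uniq_perm => //; first by rewrite filter_uniq ?iota_uniq.
    by move=> i; rewrite mem_filter mem_iota add0n; case: (boolP (i \in r)) => [/rN|].
  by rewrite lerDl sumr_ge0 // => i _; rewrite exprn_ge0 // invr_ge0.
have -> : \sum_(i <- iota 0 N) (2^-1 : R) ^+ i.+1 = 1 - 2^-1 ^+ N.
  elim: N {rN} => [|k IH]; first by rewrite big_nil expr0 subrr.
  by rewrite -addn1 iotaD big_cat IH /= big_seq1 add0n addn1 exprS; field.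
by rewrite gerBl exprn_ge0 // invr_ge0.
Qed.

(** The mass with tilt 0 is equidistributed on the columns; for it [drift] is
    bounded at all levels for this value of the exponent. A cover of small cost
    is enlarged to an open one, and [cover_cost_lower_bound] applies to a finite
    subcover, its constants being independent of the last level. *)
Lemma hausdorff_dim_ge :
  ((mean 0 / lnn + logM / ln m%:R)%:E <= hausdorff_dim Lambda)%E.
Proof.
set s0 := _ + _; apply: le_ereal_inf_tmp => _ [s [s_ge0 Hs] <-]; rewrite lee_fin leNgt.
apply/negP => ss0.
have [K KP] := cover_cost_lower_bound m_gt1 m_lt_n A_neq0 carpetL ss0.
pose W := (50%:R * expR logM)^-1 : R.
have W0 : 0 < W by rewrite invr_gt0 mulr_gt0 // expR_gt0.
pose c := expR ((ln 4 + lnn) * s).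
have c0 : 0 < c by exact: expR_gt0.
pose delta := (n%:R ^+ K)^-1 / 4 : R.
have nK : 0 < (n%:R ^+ K)^-1 :> R by rewrite invr_gt0 exprn_gt0 // ltr0n ltnW.
have delta0 : 0 < delta by rewrite divr_gt0.
have Hd : (hausdorff_content s delta Lambda <= 0)%E.
  by rewrite -Hs; apply: ereal_sup_ubound; exists delta.
have [J [U [cov dU sumU]]] : exists (J : set nat) (U : nat -> set 'rV[R]_2),
    [/\ covers J U Lambda, forall i, J i -> (diam (U i) <= delta%:E)%E &
      (cover_sum J U s < (W / (4 * c))%:E)%E].
  have /ereal_inf_ltP : (hausdorff_content s delta Lambda < (W / (4 * c))%:E)%E.
    by apply: le_lt_trans Hd _; rewrite lte_fin divr_gt0 // mulr_gt0.
  by move=> [_ [J [U [h1 h2 ->]]] h3]; exists J, U.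
pose d i := fine (diam (U i)).
have dE i : J i -> diam (U i) = (d i)%:E.
  move=> /dU h; rewrite fineK // ge0_fin_numE ?diam_ge0 //.
  by apply: le_lt_trans h _; rewrite ltry.
have [|kap kapP] := @boolp.choice _ _ (fun i k => J i ->
  [/\ (K <= k)%N, 4 * d i <= (n%:R ^+ k)^-1 &
    expR (- (k%:R * lnn) * s) <= c * d i `^ s + W / 4 * 2^-1 ^+ i.+1]).
  move=> i; case: (pselect (J i)) => [Ji|]; last by exists 0%N.
  have [|||k kP] := @exists_enclosing_level s (d i) (W / 4 * 2^-1 ^+ i.+1) K s_ge0.
  - by rewrite -lee_fin -dE // diam_ge0.
  - by rewrite !mulr_gt0 ?exprn_gt0 // invr_gt0.
  - by have := dU i Ji; rewrite dE // lee_fin /delta ler_pdivlMr // mulrC.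
  - by exists k.
pose V i := thicken (U i) ((n%:R ^+ kap i)^-1 / 8).
have rho0 i : 0 < (n%:R ^+ kap i)^-1 / 8 :> R.
  by rewrite divr_gt0 // invr_gt0 exprn_gt0 // ltr0n ltnW.
have compL : cover_compact Lambda by rewrite -compact_cover; case: carpetL.
have [||D' D'J covD'] := compL nat J V.
- by move=> i _; apply: open_thicken.
- by move=> z /cov [i Ji Uz]; exists i => //; apply: sub_thicken.
pose E := (\max_(i <- enum_fset D') kap i)%N.
have [|||r [ru rD hr]] := KP K E (fun=> 0) logM [set` D'] V kap (leqnn K) _ _ covD'.
- by move=> q; rewrite lexx ler01.
- move=> k _; rewrite /drift sumr_const card_ord big1; last first.
    by move=> q _; rewrite mul0r logmgf0 // subr0.
  have [h1 h2] := level_itv R m_gt1 m_lt_n k.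
  have -> : mean 0 *+ k - 0 + (lev k)%:R * logM - k%:R * lnn * s0 =
    ((lev k)%:R - carpet_gamma R m n * k%:R) * logM.
    by rewrite -mulr_natr /s0 /carpet_gamma; field; rewrite !gt_eqF.
  have : - 1 * logM <= ((lev k)%:R - carpet_gamma R m n * k%:R) * logM.
    by rewrite ler_wpM2r //; lra.
  by rewrite mulN1r.
- move=> i /= iD; have Ji : J i by have := D'J i iD; rewrite inE.
  have [Kk dk _] := kapP i Ji; split.
    by rewrite Kk /E (big_rem i) //= leq_maxl.
  have dUi : (diam (U i) <= (d i)%:E)%E by rewrite dE.
  apply: (le_trans (diam_thicken (rho0 i) dUi)); rewrite lee_fin; lra.
have rJ i : i \in r -> J i by move=> /rD /D'J; rewrite inE.
have h1 : \sum_(i <- r) expR (- ((kap i)%:R * lnn) * s) <=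
   c * \sum_(i <- r) d i `^ s + W / 4 * \sum_(i <- r) 2^-1 ^+ i.+1.
  rewrite !mulr_sumr -big_split /= big_seq [leRHS]big_seq; apply: ler_sum => i /rJ Ji.
  by have [] := kapP i Ji.
have h2 : \sum_(i <- r) d i `^ s < W / (4 * c).
  rewrite -lte_fin; apply: le_lt_trans sumU; apply: cover_sum_ge => // i Ji.
  by rewrite dE // poweR_EFin.
have h3 := sum_geometric_half ru.
have h4 : \sum_(i <- r) expR (- ((kap i)%:R * lnn) * s) < W.
  apply: (le_lt_trans h1).
  have e1 : c * \sum_(i <- r) d i `^ s < W / 4.
    have -> : W / 4 = c * (W / (4 * c)) by field; rewrite gt_eqF.
    by rewrite ltr_pM2l.
  have e2 : W / 4 * \sum_(i <- r) 2^-1 ^+ i.+1 <= W / 4.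
    by rewrite ler_piMr // ltW // divr_gt0.
  lra.
have h5 : expR (logM - (s0 - s) * lnn / 2 * K%:R) <= expR logM.
  by rewrite ler_expR gerBl !mulr_ge0 // ?subr_ge0 ltW // lnn_gt0.
have h6 : 2^-1 <= 25%:R * expR logM * \sum_(i <- r) expR (- ((kap i)%:R * lnn) * s).
  apply: (le_trans hr); apply: ler_wpM2r; last by rewrite ler_pM2l.
  by apply: sumr_ge0 => i _; apply: expR_ge0.
have h7 : 25%:R * expR logM * \sum_(i <- r) expR (- ((kap i)%:R * lnn) * s) <
   25%:R * expR logM * W by rewrite ltr_pM2l // mulr_gt0 // expR_gt0.
have e : 25%:R * expR logM * W = 2^-1 by rewrite /W; field; rewrite gt_eqF ?expR_gt0.
lra.
Qed.

End HausdorffLowerBound.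

(** * The rate function and the main theorem *)

Section Rate.
Variables (R : realType) (m n : nat) (A : {set 'I_m * 'I_n}).
Hypotheses (m_gt1 : (1 < m)%N) (m_lt_n : (m < n)%N).
Hypothesis A_neq0 : A != finset.set0.
Hypothesis nonuniform : nonuniform_fibres A.

Local Notation C := (columns A).
Local Notation x := (log_size R A).
Local Notation mean := (tilt_mean C x).
Local Notation Lam := (logmgf C x).
Local Notation g := (carpet_gamma R m n).
Local Notation J := (legendre01 C x).
Local Notation slope := (slope C x g).
Local Notation logM := (ln #|C|%:R : R).

Let C_neq0 : C != finset.set0. Proof. exact: columns_neq0. Qed.
Let lnn_gt0 : 0 < ln n%:R :> R. Proof. exact: ln_n_gt0 m_gt1 m_lt_n. Qed.
Let lnm_gt0 : 0 < ln m%:R :> R. Proof. exact: ln_m_gt0 m_gt1. Qed.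
Let g_gt1 : 1 < g. Proof. exact: carpet_gamma_gt1 m_gt1 m_lt_n. Qed.
Let g_gt0 : 0 < g. Proof. exact: lt_trans g_gt1. Qed.

Lemma rateE t : rate A t = ereal_sup (range (fun l : R => (l * t - Lam l)%:E)).
Proof.
rewrite /rate; congr ereal_sup; apply: eq_imagel => l _.
rewrite logmgfE; congr ((_ - ln (_ * _))%:E); apply: eq_bigr => i iC.
by rewrite /powR gt_eqF // ltr0n column_size_gt0.
Qed.

Lemma rate_ge t : ((J t)%:E <= rate A t)%E.
Proof.
rewrite rateE; case E : (ereal_sup _) => [b||]; last 2 first.
- by rewrite leey.
- have : ((0 * t - Lam 0)%:E <= -oo)%E by rewrite -E; apply: ereal_sup_ubound; exists 0.
by rewrite leeNy_eq.
rewrite lee_fin; apply: (legendre01_le C_neq0) => l _; rewrite -lee_fin -E.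
by apply: ereal_sup_ubound; exists l.
Qed.

(** At the mean of a tilt in the unit interval the tangent line attains the
    supremum over all tilts. *)
Lemma rate_mean_itv t : mean 0 <= t <= mean 1 -> rate A t = (J t)%:E.
Proof.
move=> h; have [l l01 <-] := exists_tilt (x := x) C_neq0 h.
apply/eqP; rewrite eq_le rate_ge andbT rateE legendre01_tilt //.
apply: ge_ereal_sup => _ [l' _ <-]; rewrite lee_fin.
have := logmgf_tangent x C_neq0 l l'; lra.
Qed.

(** The slopes of the theorem are at least those defined by [legendre01], and
    they agree as long as the latter are at most the mean for the tilt 1. *)
Lemma slope_le_t_iter j s t : mean 0 <= t_first A s ->
  t_iter A j.+1 s = t%:E -> slope (t_first A s) j.+1 <= t.
Proof.
move=> mu; rewrite /t_iter -pred_Sn; elim: j t => [|j IH] t.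
  by rewrite slope1 // => -[->].
rewrite iterS; case: (iter j _ _) IH => [r|//|//] IH; rewrite /t_step.
have {IH} := IH r erefl => hr; have := rate_ge r.
case: rate => [I||] //; last by rewrite gt0_muley ?lte_fin.
rewrite lee_fin => hI [<-]; rewrite slopeS lerD2l ler_pM2l //.
exact: le_trans (legendre01_nondecr x C_neq0 hr) hI.
Qed.

Lemma t_iter_slope j s : mean 0 <= t_first A s ->
  (forall i, (i <= j.+1)%N -> slope (t_first A s) i <= mean 1) ->
  t_iter A j.+1 s = (slope (t_first A s) j.+1)%:E.
Proof.
move=> mu; rewrite /t_iter -pred_Sn; elim: j => [|j IH] h; first by rewrite slope1.
rewrite iterS IH => [|i ij]; last by rewrite h // leqW.
rewrite /t_step rate_mean_itv; first by rewrite -EFinM -EFinD.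
by rewrite h // (slope_mono (i := 0) C_neq0 g_gt1 mu (leq0n j.+1)).
Qed.

Lemma ln_cardA : ln #|A|%:R = Lam 1 + logM.
Proof.
have cA : #|A|%:R = partition_fun C x 1.
  have -> : #|A|%:R = \sum_(a in A) (1 : R) by rewrite sumr_const.
  rewrite /partition_fun.
  have <- := sum_letters_column A (fun i => expR (1 * x i)).
  by apply: eq_bigr => a aA; rewrite mul1r divff // gt_eqF // expR_gt0.
have C0 : 0 < #|C|%:R :> R by apply: cardC_gt0.
rewrite cA -[Lam 1]expRK expR_logmgf // -lnM ?posrE ?divr_gt0 ?expR_gt0 //.
- by rewrite divfK // gt_eqF.
- exact: partition_fun_gt0.
Qed.

Lemma t_first_of_slope u : t_first A (u / ln n%:R + logM / ln m%:R) = u.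
Proof. by rewrite /t_first addrK divfK // gt_eqF. Qed.

Section Equation.
Variables (theta : R) (l : nat).
Hypothesis theta_gt0 : 0 < theta.
Hypotheses (theta_gt : g ^- l.+1 < theta) (theta_le : theta <= g ^- l).

Local Notation r := ((theta * g ^+ l)^-1).

(** Here [I] and [I'] are the rates at the last two slopes. *)
Lemma equation_exponent (u t I I' : R) : t = u + g * I ->
  g ^+ l.+1 * theta * (Lam 1 + logM) - (g ^+ l.+1 * theta - 1) * t +
    g * (1 - g ^+ l * theta) * (logM - I') - (u + g * logM) =
  g ^+ l.+1 * theta * (Lam 1 - u - (r - 1) * I' - (g - r) * I).
Proof.
move=> ->; rewrite exprS; have gl : g ^+ l != 0 by rewrite expf_neq0 ?gt_eqF.
by field; rewrite gl gt_eqF.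
Qed.

Lemma mul_ln_decomp s : s * ln n%:R = t_first A s + g * logM.
Proof. by rewrite /t_first /carpet_gamma; field; rewrite !gt_eqF. Qed.

Lemma gtheta_gt1 : 1 < g ^+ l.+1 * theta.
Proof. by rewrite mulrC -ltr_pdivrMr ?exprn_gt0 // mul1r. Qed.

Lemma gtheta_le1 : g ^+ l * theta <= 1.
Proof. by rewrite mulrC -ler_pdivlMr ?exprn_gt0 // mul1r. Qed.

Hypothesis L_eq : carpet_L m n theta = l.+1.

(** For a solution of the equation, the larger rates can only decrease the left
    side, hence [exponent] is nonnegative; then the slopes are bounded by
    [slope_le_mean1] and both sides of the comparison agree. *)
Lemma dim_equation_exponent s : mean 0 < t_first A s ->
  dim_equation A theta s <-> exponent C x g r l (t_first A s) = 0.
Proof.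
move=> mu; set u := t_first A s in mu *.
have G1 := gtheta_gt1; have G2 := gtheta_le1.
have rg : 1 <= r < g by apply: ratio_itv.
pose J0 := J (slope u l); pose J1 := J (slope u l.+1).
have eqE i := @equation_exponent u (slope u l.+1) J0 i erefl.
have bounded : 0 <= exponent C x g r l u ->
    [/\ t_iter A l.+1 s = (slope u l.+1)%:E & rate A (slope u l.+1) = J1%:E].
  move=> e0; have le1 i : (i <= l.+1)%N -> slope u i <= mean 1.
    by apply: (slope_le_mean1 C_neq0 (log_size_nonconst nonuniform) g_gt1 rg (ltW mu)).
  split; first exact: (t_iter_slope (ltW mu)).
  rewrite rate_mean_itv // le1 // andbT.
  exact: (slope_mono (i := 0) C_neq0 g_gt1 (ltW mu)).
have Gpos : 0 < g ^+ l.+1 * theta by apply: lt_trans G1.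
rewrite /dim_equation L_eq subn1 /= ln_cardA mul_ln_decomp -/u; split; last first.
  move=> e0; have [|h1 h2] := bounded; first by rewrite e0.
  by exists (slope u l.+1), J1; split => //; rewrite eqE [X in _ * X]e0 mulr0.
move=> [t [I [ht hI e]]].
have tge : slope u l.+1 <= t by apply: slope_le_t_iter ht; apply: ltW.
have Ige : J1 <= I.
  rewrite -lee_fin -hI; apply: le_trans (rate_ge t).
  by rewrite lee_fin legendre01_nondecr.
have e0 : 0 <= exponent C x g r l u.
  rewrite -(pmulr_rge0 _ Gpos) -[X in 0 <= _ * X]/(Lam 1 - u - (r - 1) * J1 - (g - r) * J0).
  rewrite -eqE -e.
  have h1 : (g ^+ l.+1 * theta - 1) * slope u l.+1 <= (g ^+ l.+1 * theta - 1) * t.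
    by rewrite ler_wpM2l // subr_ge0 ltW.
  have h2 : g * (1 - g ^+ l * theta) * J1 <= g * (1 - g ^+ l * theta) * I.
    by rewrite ler_wpM2l // mulr_ge0 ?subr_ge0 // ltW.
  have e1 i : g * (1 - g ^+ l * theta) * (logM - i) =
     g * (1 - g ^+ l * theta) * logM - g * (1 - g ^+ l * theta) * i by ring.
  rewrite !e1; lra.
have [h1 h2] := bounded e0.
have tE : t = slope u l.+1 by move: ht; rewrite h1 => -[].
have IE : I = J1 by move: hI; rewrite tE h2 => -[].
move: e; rewrite tE IE eqE => /eqP; rewrite mulf_eq0 gt_eqF //= => /eqP <-.
by [].
Qed.

End Equation.
End Rate.

Section Dimensions.

Lemma theta_cover_hausdorff (R : realType) (d : nat) (F : set 'rV[R]_d) (theta s : R) :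
  (forall eps, 0 < eps -> exists2 delta0, 0 < delta0 &
     forall delta, 0 < delta -> delta <= delta0 -> theta_cover theta F s eps delta) ->
  hausdorff_measure s F = 0%E.
Proof.
move=> h; have c0 delta : 0 < delta -> hausdorff_content s delta F = 0%E.
  move=> d0; apply/eqP; rewrite eq_le; apply/andP; split; last first.
    apply: le_ereal_inf_tmp => _ [J [U [_ _ ->]]].
    by apply: esum_ge0 => i _; apply: poweR_ge0.
  apply/lee_addgt0Pr => e e0; rewrite add0e.
  have [d1 d10 hd] := h e e0.
  have [|| J [U [cov UJ sumU]]] := hd (Num.min delta d1).
  - by rewrite lt_min d0.
  - by rewrite ge_min lexx orbT.
  apply: le_trans sumU; apply: ereal_inf_lbound; exists J, U; split => // i /UJ [_].
  by move/le_trans; apply; rewrite lee_fin ge_min lexx.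
apply/eqP; rewrite eq_le; apply/andP; split.
  by apply: ge_ereal_sup => _ [delta /= /c0 -> <-].
rewrite -(c0 1 ltr01); apply: ereal_sup_ubound; by exists 1 => /=.
Qed.

Variables (R : realType) (m n : nat) (A : {set 'I_m * 'I_n}).
Variable Lambda : set 'rV[R]_2.
Hypotheses (m_gt1 : (1 < m)%N) (m_lt_n : (m < n)%N).
Hypothesis A_neq0 : A != finset.set0.
Hypothesis carpetL : is_carpet A Lambda.
Hypothesis nonuniform : nonuniform_fibres A.

Local Notation C := (columns A).
Local Notation x := (log_size R A).
Local Notation g := (carpet_gamma R m n).
Local Notation dim_of u := (u / ln n%:R + ln #|C|%:R / ln m%:R).

Let lnn_gt0 : 0 < ln n%:R :> R. Proof. exact: ln_n_gt0 m_gt1 m_lt_n. Qed.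
Let lnm_gt0 : 0 < ln m%:R :> R. Proof. exact: ln_m_gt0 m_gt1. Qed.
Let g_gt1 : 1 < g. Proof. exact: carpet_gamma_gt1 m_gt1 m_lt_n. Qed.
Let g_gt0 : 0 < g. Proof. exact: lt_trans g_gt1. Qed.
Let C_neq0 : C != finset.set0. Proof. exact: columns_neq0. Qed.

Lemma dim_of_ge0 u : tilt_mean C x 0 < u -> 0 <= dim_of u.
Proof.
move=> h; have /andP[m0 _] := tilt_mean_bounds A_neq0 (0 : R).
apply: addr_ge0; first by rewrite divr_ge0 ?(ltW lnn_gt0) // (le_trans m0) // ltW.
by rewrite divr_ge0 ?(ltW lnm_gt0) // ln_ge0 // ler1n card_gt0.
Qed.

Section Theta.
Variables (theta : R) (l : nat).
Hypotheses (theta_gt0 : 0 < theta) (theta_lt1 : theta < 1).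
Hypotheses (theta_gt : g ^- l.+1 < theta) (theta_le : theta <= g ^- l).
Local Notation r := ((theta * g ^+ l)^-1).
Variable u : R.
Hypotheses (u_gt : tilt_mean C x 0 < u) (u_root : exponent C x g r l u = 0).

(** The two defining sets of exponents both contain what exceeds the root and
    contain nothing below it. *)
Lemma theta_dims : lower_theta_dim theta Lambda = (dim_of u)%:E /\
  upper_theta_dim theta Lambda = (dim_of u)%:E.
Proof.
have above := theta_cover_above m_gt1 m_lt_n A_neq0 carpetL nonuniform
  theta_gt0 theta_lt1 theta_gt theta_le u_gt u_root.
have below := theta_cover_below m_gt1 m_lt_n A_neq0 carpetL nonuniform
  theta_gt0 theta_gt theta_le u_gt u_root.
have s0 := dim_of_ge0 u_gt.
have infE (S : set R) : (forall s, S s -> dim_of u <= s) ->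
    (forall s, dim_of u < s -> S s) ->
    ereal_inf [set s%:E | s in S] = (dim_of u)%:E.
  move=> lo hi; apply/eqP; rewrite eq_le; apply/andP; split.
    apply/lee_addgt0Pr => e e0; apply: ereal_inf_lbound.
    by exists (dim_of u + e); rewrite ?EFinD //; apply: hi; rewrite ltrDl.
  by apply: le_ereal_inf_tmp => _ [s Ss <-]; rewrite lee_fin lo.
split; apply: infE.
- move=> s [sge0 hs]; rewrite leNgt; apply/negP => lt_s.
  have [d0 d00 hd] := below s sge0 lt_s.
  have [delta [h1 h2 h3]] := hs 1 ltr01 d0 d00.
  exact: hd delta h1 h2 h3.
- move=> s lt_s; split; first by rewrite (le_trans s0) // ltW.
  move=> e e0 d1 d10; have [d0 d00 hd] := above s e lt_s e0.
  have m0 : 0 < Num.min d0 d1 by rewrite lt_min d00.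
  exists (Num.min d0 d1); split => //; first by rewrite ge_min lexx orbT.
  by apply: hd => //; rewrite ge_min lexx.
- move=> s [sge0 hs]; rewrite leNgt; apply/negP => lt_s.
  have [d0 d00 hd] := below s sge0 lt_s.
  have [d1 [d10 hd1]] := hs 1 ltr01.
  have m0 : 0 < Num.min d0 d1 by rewrite lt_min d00.
  apply: (hd (Num.min d0 d1)) => //; first by rewrite ge_min lexx.
  by apply: hd1 => //; rewrite ge_min lexx orbT.
- move=> s lt_s; split; first by rewrite (le_trans s0) // ltW.
  by move=> e e0; have [d0 d00 hd] := above s e lt_s e0; exists d0.
Qed.

(** Covers of the intermediate dimensions are covers of the Hausdorff
    dimension. *)
Lemma hausdorff_dim_le s : dim_of u < s -> (hausdorff_dim Lambda <= s%:E)%E.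
Proof.
move=> lt_s; apply: ereal_inf_lbound; exists s => //; split.
  by rewrite (le_trans (dim_of_ge0 u_gt)) // ltW.
apply: (@theta_cover_hausdorff _ _ _ theta) => e e0.
exact: (theta_cover_above m_gt1 m_lt_n A_neq0 carpetL nonuniform
  theta_gt0 theta_lt1 theta_gt theta_le u_gt u_root).
Qed.

End Theta.
End Dimensions.

Theorem theorem2p1 (R : realType) (m n : nat) (A : {set 'I_m * 'I_n})
    (Lambda : set 'rV[R]_2) (m_ge2 : (2 <= m)%N) (m_lt_n : (m < n)%N)
    (A_neq0 : A != finset.set0) (M_gt1 : (1 < #|columns A|)%N)
    (carpetL : is_carpet A Lambda) (nonuniform : nonuniform_fibres A)
    (theta : R) (theta_gt0 : 0 < theta) (theta_lt1 : theta < 1) :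
  let g := carpet_gamma R m n in
  let L := carpet_L m n theta in
  [/\ lower_theta_dim theta Lambda = upper_theta_dim theta Lambda,
      g ^- L < theta /\ theta <= g ^- (L - 1)
    & exists s : R,
        [/\ unique (fun s' : R =>
              (hausdorff_dim Lambda < s'%:E)%E /\
              (s'%:E < box_dim Lambda)%E /\
              dim_equation A theta s') s,
            lower_theta_dim theta Lambda = s%:E
          & upper_theta_dim theta Lambda = s%:E]].
Proof.
move=> g L.
have g_gt1 : 1 < g by exact: carpet_gamma_gt1 m_ge2 m_lt_n.
have g_gt0 : 0 < g by apply: lt_trans g_gt1.
have lng : 0 < ln g by rewrite ln_gt0.
have lnn : 0 < ln n%:R :> R by exact: ln_n_gt0 m_ge2 m_lt_n.
have C0 := columns_neq0 A_neq0.
pose l := Num.truncn (- ln theta / ln g).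
have LE : L = l.+1 by [].
have q0 : 0 <= - ln theta / ln g.
  by rewrite divr_ge0 ?(ltW lng) // oppr_ge0 ltW // ln_lt0 // theta_gt0.
have /andP[l1 l2] := truncn_itv q0.
have gXE k : g ^- k = expR (- (k%:R * ln g)).
  by rewrite expRN mulrC expRM_natr lnK.
have thE : theta = expR (ln theta) by rewrite lnK.
have theta_gt : g ^- l.+1 < theta.
  by rewrite gXE thE ltr_expR ltrNl -ltr_pdivrMr.
have theta_le : theta <= g ^- l.
  by rewrite gXE [leLHS]thE ler_expR lerNr -ler_pdivlMr.
have rg := ratio_itv m_ge2 m_lt_n theta_gt0 theta_gt theta_le.
set r := (theta * g ^+ l)^-1 in rg.
pose x := log_size R A.
have nonc : ~ {in columns A &, forall i j, x i = x j} := log_size_nonconst nonuniform.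
have r1 k : ((k == 0%N) ==> (1 < (theta * g ^+ k)^-1)).
  by apply/implyP => /eqP ->; rewrite expr0 mulr1 invf_gt1.
have [u [u1 u2 u0]] := exists_exponent_root C0 nonc g_gt1 rg (r1 l).
have [lowE upE] := theta_dims m_ge2 m_lt_n A_neq0 carpetL nonuniform
  theta_gt0 theta_lt1 theta_gt theta_le u1 u0.
rewrite LE subn1 lowE upE; split => //.
set s := _ + _; exists s; split => //.
have sE : t_first A s = u by exact: t_first_of_slope.
have eqP' := dim_equation_exponent m_ge2 m_lt_n A_neq0 nonuniform theta_gt0 theta_gt theta_le LE.
split; last first.
  move=> s' [s1 [_ s3]].
  have mu : tilt_mean (columns A) x 0 < t_first A s'.
    have h := le_lt_trans (hausdorff_dim_ge m_ge2 m_lt_n A_neq0 carpetL) s1.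
    move: h; rewrite lte_fin -ltrBrDr ltr_pdivrMr //.
  move/(eqP' _ mu): s3 => e'.
  have uE : t_first A s' = u.
    have [h|h|//] := ltgtP (t_first A s') u.
      have := exponent_decr x C0 g_gt1 l rg h; by rewrite e' u0 ltxx.
    have := exponent_decr x C0 g_gt1 l rg h; by rewrite e' u0 ltxx.
  have : t_first A s' = t_first A s by rewrite uE sE.
  rewrite /t_first => /(mulIf (lt0r_neq0 lnn)) /addIr; exact.
split; last split.
- (* The root for [theta / g] is smaller. *)
  have th'0 : 0 < theta / g by rewrite divr_gt0.
  have th'1 : theta / g < 1 by rewrite ltr_pdivrMr // mul1r (lt_trans theta_lt1).
  have th'gt : g ^- l.+2 < theta / g.
    by rewrite exprS invfM mulrC ltr_pM2r // invr_gt0.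
  have th'le : theta / g <= g ^- l.+1.
    by rewrite exprS (invfM g) [leRHS]mulrC ler_pM2r // invr_gt0.
  have rE : (theta / g * g ^+ l.+1)^-1 = r.
    by rewrite exprS mulrA divfK // gt_eqF.
  have [v [v1 v2 v0]] := exists_exponent_root C0 nonc g_gt1 (l := l.+1) rg isT.
  have lt0 := exponent_succ_lt C0 nonc g_gt1 rg u1 u0.
  have vu : v < u.
    rewrite ltNge le_eqVlt; apply/negP => /predU1P[e|h].
      by move: lt0; rewrite e v0 ltxx.
    by have := exponent_decr x C0 g_gt1 l.+1 rg h; rewrite v0 ltNge (ltW lt0).
  pose s2 := (v + u) / 2 / ln n%:R + ln #|columns A|%:R / ln m%:R.
  apply: (@le_lt_trans _ _ s2%:E).
    rewrite -rE in v0.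
    apply: (hausdorff_dim_le m_ge2 m_lt_n A_neq0 carpetL nonuniform th'0 th'1 th'gt th'le v1 v0).
    by rewrite ltrD2r ltr_pM2r ?invr_gt0 // (midf_lt vu).
  by rewrite lte_fin ltrD2r ltr_pM2r ?invr_gt0 // (midf_lt vu).
- rewrite (box_dim_carpet m_ge2 m_lt_n A_neq0 carpetL) lte_fin ltrD2r.
  by rewrite ltr_pM2r // invr_gt0.
- by apply/eqP'; rewrite sE.
Qed.
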